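(* Let $(p,q)\in G$, $u\in T_pM$ and $\bar v\in T_qM'$. Let $\gamma(s)=(p(s),f(p(s)))$ be a primal geodesic (a geodesic of $\nabla$) and $\sigma(t)=(f^{-1}(q'(t)),q'(t))$ a dual geodesic (a geodesic of $\nabla^*$) in $G$ with $\gamma(0)=\sigma(0)=(p,q)$, $\dot p(0)=u$ and $\dot q'(0)=\bar v$. Then the Ma-Trudinger-Wang tensor can be expressed as $$\mathfrak S(u,\bar v)=-\frac{\partial^4}{\partial s^2\partial t^2}\mathbf D[\gamma(s):\sigma(t)]\Big|_{s=t=0}.$$
   Context: Setting. $M,M'$ are $n$-dimensional smooth manifolds ($n\ge 2$), and $c:M\times M'\to\mathbb R$ is a smooth cost function. In local coordinates $\xi=(\xi^1,\dots,\xi^n)$ on $M$ and $\eta'=(\eta'^{\bar 1},\dots,\eta'^{\bar n})$ on $M'$ write $c_{i:\bar j}=\frac{\partial^2 c}{\partial\xi^i\partial\eta'^{\bar j}}$. The cost is assumed non-degenerate: the matrix $(c_{i:\bar j})$ is invertible at every point. Einstein summation is used. Optimal transport map. $\varphi:M\to\mathbb R$ is smooth and $c$-concave, i.e. there is $\psi:M'\to\mathbb R\cup\{-\infty\}$ with $\varphi(p)=\inf_{q'\in M'}(c(p,q')-\psi(q'))$ for all $p\in M$. For each $p\in M$ there is a unique $q'=:D^c\varphi(p)\in M'$ with $\varphi(p)+\psi(q')=c(p,q')$, and $f=D^c\varphi$ is a smooth diffeomorphism from $M$ onto its range $f(M)\subset M'$. $\psi$ is the $c$-transform of $\varphi$: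 $\psi(q)=\inf_{p\in M}(c(p,q)-\varphi(p))$, so $\psi(q)=c(f^{-1}(q),q)-\varphi(f^{-1}(q))$ for $q\in f(M)$. The graph $G=\{(p,f(p)):p\in M\}$ is an $n$-dimensional embedded submanifold of $M\times M'$. $c$-divergence and dualistic structure. For $x=(p,q),\,x'=(p',q')\in G$, $\mathbf D[x:x']=c(p,q')-\varphi(p)-\psi(q')$. Using coordinates $\xi$ on $G$ via $(p,f(p))\mapsto p$ and writing $\mathbf D=\mathbf D[\xi:\xi']$, define $g_{ij}(\xi)=-\frac{\partial}{\partial\xi^i}\frac{\partial}{\partial\xi'^j}\mathbf D\big|_{\xi'=\xi}$ (a Riemannian metric on $G$), $\Gamma_{ijk}(\xi)=-\frac{\partial^2}{\partial\xi^i\partial\xi^j}\frac{\partial}{\partial\xi'^k}\mathbf D\big|_{\xi'=\xi}$, $\Gamma^*_{ijk}(\xi)=-\frac{\partial^2}{\partial\xi'^i\partial\xi'^j}\frac{\partial}{\partial\xi^k}\mathbf D\big|_{\xi'=\xi}$. The torsion-free connections $\nabla,\nabla^*$ on $G$ have Christoffel symbols $\Gamma_{ij}{}^k=\Gamma_{ijm}g^{mk}$ and $\Gamma^*_{ij}{}^k=\Gamma^*_{ijm}g^{mk}$, with $\nabla_{\partial_i}\partial_j=\Gamma_{ij}{}^k\partial_k$ (similarly for $\nabla^*$). Pseudo-Riemannian metric $h$ on $M\times M'$. For $v=a^i\frac{\partial}{\partial\xi^i}+b^{\bar i}\frac{\partial}{\partial\eta'^{\bar i}}$ at $(\xi,\eta')$,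 $h(v,v)=-c_{i:\bar j}(\xi,\eta')a^ib^{\bar j}$, extended by polarization. $\bar\nabla$ is the Levi-Civita connection of $h$, with curvature $\bar R(X,Y)Z=\bar\nabla_X\bar\nabla_YZ-\bar\nabla_Y\bar\nabla_XZ-\bar\nabla_{[X,Y]}Z$, and $\overline{\sec}_u(X,Y)=h(\bar R(X,Y)Y,X)$. MTW tensor. For $(p,q')\in M\times M'$, $u\in T_pM$, $\bar v\in T_{q'}M'$: $\mathfrak S(u,\bar v)=2\,\overline{\sec}_u(u\oplus 0,\,0\oplus\bar v)$, with respect to $T_{(p,q')}(M\times M')=T_pM\oplus T_{q'}M'$. *)

(* Defs.v *)
From HB Require Import structures.
From mathcomp Require Import all_boot all_order all_algebra.
From mathcomp Require Import all_classical all_reals all_analysis.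
From mathcomp Require Import ring lra.
Set Implicit Arguments.
Unset Strict Implicit.
Unset Printing Implicit Defensive.
Import Order.TTheory GRing.Theory Num.Theory.
Import numFieldNormedType.Exports.
Local Open Scope classical_set_scope.
Local Open Scope ring_scope.

(* C^infinity at every point of U (U is open in every use): all iterated
   directional derivatives are Frechet differentiable there. *)
Definition smooth_on (R : realType) (V W : normedModType R) (U : set V)
    (F : V -> W) : Prop :=
  forall (vs : seq V) (z : V), U z ->
    differentiable (foldr (fun v G => 'D_v G) F vs) z.

(* cmap and cinv are total functions; their values outside cdom and cimg are
   irrelevant. *)
Record chart (R : realType) (n : nat) (M : Type) := Chart {
  cdom : set M;
  cmap : M -> 'rV[R]_n;
  cinv : 'rV[R]_n -> M }.

Definition cimg (R : realType) (n : nat) (M : Type) (x : chart R n M) :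
  set 'rV[R]_n := cmap x @` cdom x.

Definition is_chart (R : realType) (n : nat) (M : topologicalType)
    (x : chart R n M) : Prop :=
  [/\ open (cdom x), open (cimg x),
      (forall p, cdom x p -> cinv x (cmap x p) = p),
      (forall p, cdom x p -> {for p, continuous (cmap x)}) &
      (forall xi, cimg x xi -> {for xi, continuous (cinv x)})].

(* The atlas is not required to be maximal. *)
Record smooth_manifold (R : realType) (n : nat) (M : topologicalType) :=
  SmoothManifold {
  atlas : set (chart R n M);
  manifold_hausdorff : hausdorff_space M;
  manifold_second_countable : @second_countable M;
  atlas_chart : forall x, atlas x -> is_chart x;
  atlas_cover : forall p : M, exists2 x, atlas x & cdom x p;
  atlas_compat : forall x y, atlas x -> atlas y ->
    smooth_on (cmap x @` (cdom x `&` cdom y)) (cmap y \o cinv x) }.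

Definition smooth_fun (R : realType) (n : nat) (M : topologicalType)
    (A : smooth_manifold R n M) (phi : M -> R) : Prop :=
  forall x, atlas A x -> smooth_on (cimg x) (phi \o cinv x).

Definition smooth_fun2 (R : realType) (n n' : nat) (M M' : topologicalType)
    (A : smooth_manifold R n M) (A' : smooth_manifold R n' M')
    (c : M -> M' -> R) : Prop :=
  forall x y, atlas A x -> atlas A' y ->
    smooth_on [set z : 'rV[R]_(n + n') | cimg x (lsubmx z) /\ cimg y (rsubmx z)]
      (fun z => c (cinv x (lsubmx z)) (cinv y (rsubmx z))).

Definition smooth_map_on (R : realType) (n n' : nat) (M M' : topologicalType)
    (A : smooth_manifold R n M) (A' : smooth_manifold R n' M')
    (U : set M) (f : M -> M') : Prop :=
  (forall p, U p -> {for p, continuous f}) /\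
  forall x y, atlas A x -> atlas A' y ->
    smooth_on (cmap x @` (cdom x `&` U `&` f @^-1` cdom y))
      (cmap y \o f \o cinv x).

Definition smooth_curve (R : realType) (n : nat) (M : topologicalType)
    (A : smooth_manifold R n M) (I : set R) (p : R -> M) : Prop :=
  (forall s, I s -> {for s, continuous p}) /\
  forall x, atlas A x ->
    smooth_on (I `&` p @^-1` cdom x : set R^o) (cmap x \o p : R^o -> _).

(* finv is the inverse of f on the (open) set range f; elsewhere its values
   are irrelevant. *)
Definition diffeo_onto_range (R : realType) (n : nat) (M M' : topologicalType)
    (A : smooth_manifold R n M) (A' : smooth_manifold R n M')
    (f : M -> M') (finv : M' -> M) : Prop :=
  [/\ cancel f finv, open (range f), smooth_map_on A A' setT f &
      smooth_map_on A' A (range f) finv].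

Definition basis_vec (R : realType) (m : nat) (i : 'I_m) : 'rV[R]_m :=
  delta_mx 0 i.

Definition partial (R : realType) (m : nat) (i : 'I_m) (F : 'rV[R]_m -> R)
    (z : 'rV[R]_m) : R := 'D_(basis_vec R i) F z.

(* Christoffel symbols G i j k stand for Gamma_{ij}^k. *)
Definition christoffel_symbols (R : realType) (m : nat) : Type :=
  'I_m -> 'I_m -> 'I_m -> 'rV[R]_m -> R.

Definition covariant (R : realType) (m : nat) (G : christoffel_symbols R m)
    (X Y : 'rV[R]_m -> 'rV[R]_m) (z : 'rV[R]_m) : 'rV[R]_m :=
  'D_(X z) Y z +
  \row_k \sum_(i < m) \sum_(j < m) G i j k z * X z 0 i * Y z 0 j.

Definition lie_bracket (R : realType) (m : nat)
    (X Y : 'rV[R]_m -> 'rV[R]_m) (z : 'rV[R]_m) : 'rV[R]_m :=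
  'D_(X z) Y z - 'D_(Y z) X z.

Definition curvature (R : realType) (m : nat) (G : christoffel_symbols R m)
    (X Y Z : 'rV[R]_m -> 'rV[R]_m) (z : 'rV[R]_m) : 'rV[R]_m :=
  covariant G X (covariant G Y Z) z - covariant G Y (covariant G X Z) z
  - covariant G (lie_bracket X Y) Z z.

(* A field of bilinear forms: h z v w is the value at the point z. *)
Definition form_field (R : realType) (m : nat) : Type :=
  'rV[R]_m -> 'rV[R]_m -> 'rV[R]_m -> R.

Definition gram (R : realType) (m : nat) (h : form_field R m)
    (z : 'rV[R]_m) : 'M[R]_m :=
  \matrix_(i, j) h z (basis_vec R i) (basis_vec R j).

Definition levi_civita (R : realType) (m : nat) (h : form_field R m) :
    christoffel_symbols R m := fun i j k z =>
  \sum_(l < m) 2^-1 * (partial i (fun w => gram h w j l) z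
                       + partial j (fun w => gram h w i l) z
                       - partial l (fun w => gram h w i j) z)
               * invmx (gram h z) l k.

(* levi_civita h is characterized as the torsion-free connection that is
   compatible with h. *)
Definition torsion_free_metric (R : realType) (m : nat) (h : form_field R m)
    (G : christoffel_symbols R m) (z : 'rV[R]_m) : Prop :=
  (forall i j k, G i j k z = G j i k z) /\
  (forall i j k, partial i (fun w => gram h w j k) z =
     \sum_(l < m) (G i j l z * gram h z l k + G i k l z * gram h z j l)).

Lemma levi_civitaP (R : realType) (m : nat) (h : form_field R m)
    (G : christoffel_symbols R m) (z : 'rV[R]_m) :
  (forall w v v', h w v v' = h w v' v) -> gram h z \in unitmx ->
  torsion_free_metric h G z <->
  (forall i j k, G i j k z = levi_civita h i j k z).
Proof.
move=> hsym hU.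
have gsym w i j : gram h w i j = gram h w j i by rewrite !mxE hsym.
have psym a i j : partial a (fun w => gram h w i j) z =
                  partial a (fun w => gram h w j i) z.
  by congr partial; apply/funext => w; exact: gsym.
pose K i j l := 2^-1 * (partial i (fun w => gram h w j l) z
                       + partial j (fun w => gram h w i l) z
                       - partial l (fun w => gram h w i j) z).
have lower i j l : \sum_k levi_civita h i j k z * gram h z k l = K i j l.
  pose r : 'rV_m := \row_l K i j l.
  have -> : \sum_k levi_civita h i j k z * gram h z k l =
            (r *m invmx (gram h z) *m gram h z) 0 l.
    rewrite mxE; apply: eq_bigr => k _; congr (_ * _).
    by rewrite mxE; apply: eq_bigr => a _; rewrite mxE.
  by rewrite -mulmxA mulVmx // mulmx1 mxE.
have upper (T : christoffel_symbols R m) i j :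
    (forall l, \sum_k T i j k z * gram h z k l = K i j l) ->
    forall k, T i j k z = levi_civita h i j k z.
  move=> TK k; pose r : 'rV_m := \row_k T i j k z.
  have -> : T i j k z = (r *m gram h z *m invmx (gram h z)) 0 k.
    by rewrite -mulmxA mulmxV // mulmx1 mxE.
  rewrite mxE; apply: eq_bigr => l _; congr (_ * _).
  by rewrite -/(K i j l) -TK mxE; apply: eq_bigr => a _; rewrite mxE.
split=> [[tf mc] i j|GE].
  apply: upper => l.
  pose L a b d := \sum_k G a b k z * gram h z k d.
  have LS a b d : L a b d = L b a d.
    by apply: eq_bigr => k _; rewrite tf.
  have mc' a b d : partial a (fun w => gram h w b d) z = L a b d + L a d b.
    rewrite mc big_split; congr (_ + _).
    by apply: eq_bigr => k _; rewrite gsym.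
  rewrite -/(L i j l) /K !mc' (LS l i j) (LS l j i) (LS j i l).
  lra.
have KS i j l : K i j l = K j i l.
  by rewrite /K (psym l i j) [partial i _ z + _]addrC.
split=> [i j k|i j k].
  rewrite !GE /levi_civita; apply: eq_bigr => l _.
  by congr (_ * _); exact: KS.
rewrite big_split /=.
have -> : \sum_l G i j l z * gram h z l k = K i j k.
  by rewrite -lower; apply: eq_bigr => l _; rewrite GE.
have -> : \sum_l G i k l z * gram h z j l = K i k j.
  by rewrite -lower; apply: eq_bigr => l _; rewrite GE gsym.
rewrite /K (psym i k j) (psym j i k) (psym k i j); lra.
Qed.

Definition c_concave (R : realType) (M M' : Type) (c : M -> M' -> R)
    (phi : M -> R) : Prop :=
  exists2 psi0 : M' -> \bar R, (forall q, psi0 q != +oo%E) &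
    forall p, (phi p)%:E = ereal_inf [set ((c p q)%:E - psi0 q)%E | q in setT].

Definition c_transform (R : realType) (M M' : Type) (c : M -> M' -> R)
    (phi : M -> R) (q : M') : \bar R :=
  ereal_inf [set (c p q - phi p)%:E | p in setT].

(* f = D^c phi: f p is the unique q with phi p + psi q = c p q. *)
Definition is_c_gradient (R : realType) (M M' : Type) (c : M -> M' -> R)
    (phi : M -> R) (f : M -> M') : Prop :=
  forall p q, ((phi p)%:E + c_transform c phi q)%E = (c p q)%:E <-> q = f p.

Definition graph (M M' : Type) (f : M -> M') : set (M * M') :=
  [set w | w.2 = f w.1].

(* Meaningful for w, w' in graph f, where the c-transform is finite. *)
Definition c_divergence (R : realType) (M M' : Type) (c : M -> M' -> R)
    (phi : M -> R) (w w' : M * M') : R :=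
  c w.1 w'.2 - phi w.1 - fine (c_transform c phi w'.2).

(* The divergence in the coordinates (p, f p) |-> cmap x p of the graph. *)
Definition local_divergence (R : realType) (n : nat) (M M' : Type)
    (c : M -> M' -> R) (phi : M -> R) (f : M -> M') (x : chart R n M)
    (xi xi' : 'rV[R]_n) : R :=
  c_divergence c phi (cinv x xi, f (cinv x xi)) (cinv x xi', f (cinv x xi')).

Definition div_metric (R : realType) (n : nat)
    (D : 'rV[R]_n -> 'rV[R]_n -> R) (xi : 'rV[R]_n) : 'M[R]_n :=
  \matrix_(i, j) - partial i (fun a => partial j (fun b => D a b) xi) xi.

Definition primal_lower (R : realType) (n : nat)
    (D : 'rV[R]_n -> 'rV[R]_n -> R) (i j k : 'I_n) (xi : 'rV[R]_n) : R :=
  - partial i (partial j (fun a => partial k (fun b => D a b) xi)) xi.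

Definition dual_lower (R : realType) (n : nat)
    (D : 'rV[R]_n -> 'rV[R]_n -> R) (i j k : 'I_n) (xi : 'rV[R]_n) : R :=
  - partial i (partial j (fun b => partial k (fun a => D a b) xi)) xi.

Definition raise_index (R : realType) (n : nat) (g : 'rV[R]_n -> 'M[R]_n)
    (L : christoffel_symbols R n) : christoffel_symbols R n :=
  fun i j k xi => \sum_(m < n) L i j m xi * invmx (g xi) m k.

Definition primal_connection (R : realType) (n : nat)
    (D : 'rV[R]_n -> 'rV[R]_n -> R) : christoffel_symbols R n :=
  raise_index (div_metric D) (primal_lower D).

Definition dual_connection (R : realType) (n : nat)
    (D : 'rV[R]_n -> 'rV[R]_n -> R) : christoffel_symbols R n :=
  raise_index (div_metric D) (dual_lower D).

(* Smooth curves in the graph of f, parametrized by I, that solve the geodesic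
   equation in every chart x of the atlas, where conn x gives the Christoffel
   symbols in the coordinates (p, f p) |-> cmap x p. *)
Definition graph_geodesic (R : realType) (n : nat) (M M' : topologicalType)
    (A : smooth_manifold R n M) (f : M -> M')
    (conn : chart R n M -> christoffel_symbols R n)
    (I : set R) (gam : R -> M * M') : Prop :=
  [/\ (forall s, I s -> graph f (gam s)),
      smooth_curve A I (fun s => (gam s).1) &
      forall x, atlas A x -> forall s, I s -> cdom x (gam s).1 ->
        let w := fun r : R => cmap x (gam r).1 in
        forall k : 'I_n,
          derive1n 2 w s 0 k + \sum_(i < n) \sum_(j < n)
            conn x i j k (w s) * derive1 w s 0 i * derive1 w s 0 j = 0].

Definition primal_geodesic (R : realType) (n : nat) (M M' : topologicalType)
    (A : smooth_manifold R n M) (c : M -> M' -> R) (phi : M -> R)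
    (f : M -> M') (I : set R) (gam : R -> M * M') : Prop :=
  graph_geodesic A f
    (fun x => primal_connection (local_divergence c phi f x)) I gam.

Definition dual_geodesic (R : realType) (n : nat) (M M' : topologicalType)
    (A : smooth_manifold R n M) (c : M -> M' -> R) (phi : M -> R)
    (f : M -> M') (I : set R) (gam : R -> M * M') : Prop :=
  graph_geodesic A f
    (fun x => dual_connection (local_divergence c phi f x)) I gam.

Definition local_cost (R : realType) (n : nat) (M M' : Type)
    (c : M -> M' -> R) (x : chart R n M) (y : chart R n M')
    (xi eta : 'rV[R]_n) : R := c (cinv x xi) (cinv y eta).

Definition cross_hessian (R : realType) (n : nat)
    (C : 'rV[R]_n -> 'rV[R]_n -> R) (xi eta : 'rV[R]_n) : 'M[R]_n :=
  \matrix_(i, j) partial i (fun a => partial j (fun b => C a b) eta) xi.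

Definition nondegenerate_cost (R : realType) (n : nat)
    (M M' : topologicalType) (A : smooth_manifold R n M)
    (A' : smooth_manifold R n M') (c : M -> M' -> R) : Prop :=
  forall x y p q, atlas A x -> atlas A' y -> cdom x p -> cdom y q ->
    cross_hessian (local_cost c x y) (cmap x p) (cmap y q) \in unitmx.

(* Tangent vectors to the product are row vectors row_mx a b, with a tangent
   to M and b tangent to M'. *)
Definition h_quad (R : realType) (n : nat)
    (C : 'rV[R]_n -> 'rV[R]_n -> R) (z v : 'rV[R]_(n + n)) : R :=
  - \sum_(i < n) \sum_(j < n)
      cross_hessian C (lsubmx z) (rsubmx z) i j * lsubmx v 0 i * rsubmx v 0 j.

Definition h_form (R : realType) (n : nat)
    (C : 'rV[R]_n -> 'rV[R]_n -> R) : form_field R (n + n) := fun z v w =>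
  2^-1 * (h_quad C z (v + w) - h_quad C z v - h_quad C z w).

(* h(R(X,Y)Y, X), not normalized by the area of X and Y. *)
Definition sec (R : realType) (m : nat) (h : form_field R m)
    (X Y : 'rV[R]_m -> 'rV[R]_m) (z : 'rV[R]_m) : R :=
  h z (curvature (levi_civita h) X Y Y z) (X z).

(* u and v are the components of the tangent vectors at p and q in the charts
   x and y; the curvature, being tensorial, is evaluated on their extensions
   with constant components. *)
Definition mtw_tensor (R : realType) (n : nat) (M M' : Type)
    (c : M -> M' -> R) (x : chart R n M) (y : chart R n M') (p : M) (q : M')
    (u v : 'rV[R]_n) : R :=
  2 * sec (h_form (local_cost c x y))
        (cst (row_mx u 0)) (cst (row_mx 0 v)) (row_mx (cmap x p) (cmap y q)).

(* Main.v *)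
Require Import Defs.
From mathcomp Require Import all_boot all_order all_algebra.
From mathcomp Require Import all_classical all_reals all_analysis.
From mathcomp Require Import ring lra.
Set Implicit Arguments.
Unset Strict Implicit.
Unset Printing Implicit Defensive.
Import Order.TTheory GRing.Theory Num.Theory.
Import numFieldNormedType.Exports.
Local Open Scope classical_set_scope.
Local Open Scope ring_scope.

(* In the coordinates given by charts x at p and y at q the cost is a function
   E of (xi, eta); write D_u, D_v for its derivatives along (u, 0) and (0, v).
   - The Christoffel symbols of h vanish when a barred and an unbarred index are
     mixed, so 2 sec(u, v) = D_u D_u D_w E - D_u D_u D_v D_v E, where w is
     determined by D_a D_w E = D_a D_v D_v E for all a.
   - Lowering the index with g, the primal geodesic equation for xi(s) says that
     D_xi'' D_b E + D_u D_u D_b E = 0 for all b. The dual one is written in the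
     variable p(t) = f^-1(q'(t)); since g is symmetric (the derivative of the
     divergence vanishes on the diagonal, where it is minimal), the chain rule
     turns it into D_eta'' D_a E + D_v D_v D_a E = 0 for all a, eta being the
     coordinates of q'(t). Hence w = - eta''.
   - The terms of the divergence in phi and psi depend on one parameter only, so
     its fourth derivative is that of E(xi(s), eta(t)), namely
     (D_u D_u + D_xi'') (D_v D_v + D_eta'') E. By the two equations this is
     D_u D_u D_v D_v E + D_u D_u D_eta'' E = - 2 sec(u, v). *)

(* Off by one: Ck 0 is differentiability near z, so Ck k implies C^k there. *)
Fixpoint Ck (R : realType) (V W : normedModType R) (k : nat) (F : V -> W)
    (z : V) : Prop :=
  (\forall y \near z, differentiable F y) /\
  (if k is k'.+1 then forall v, Ck k' ('D_v F) z else True).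

Lemma near_near (T : topologicalType) (z : T) (P : T -> Prop) :
  (\forall y \near z, P y) -> \forall y \near z, \forall w \near y, P w.
Proof. exact: nbhs_interior. Qed.

(** * Maps of finite differentiability class on normed spaces *)

Section Ck.
Variables (R : realType) (V : normedModType R).

(** The zero map satisfies the first-order expansion that characterizes the differential, with a
    remainder that vanishes near [z]. This is the case from which differentiability is seen to be
    local, any two maps equal near [z] differing by such an [H]. *)
Lemma near0_differentiable (W : normedModType R) (H : V -> W) (z : V) :
  (\forall y \near z, H y = 0) -> differentiable H z.
Proof.
move=> H0; have Hz : H z = 0 by exact: nbhs_singleton H0.
have c0 : continuous (\0 : V -> W) by move=> y; exact: cvg_cst.
have e0 : H \o shift z = cst (H z) + (\0 : V -> W) +o_ 0 id.
  apply/eqaddoP => _/posnumP[e]; near=> y.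
  rewrite /= !fctE Hz addr0 subr0.
  have -> : H (y + z) = 0 by
    near: y; have /nbhs0P := H0; apply: filterS => y <-; rewrite addrC.
  by rewrite normr0 mulr_ge0.
have /= dE := @diff_unique _ _ _ H (\0 : {linear V -> W}) z c0 e0.
by apply/diff_locallyP; rewrite dE.
Unshelve. all: by end_near. Qed.

Lemma near_eq_differentiable (W : normedModType R) (F G : V -> W) (z : V) :
  (\forall y \near z, F y = G y) -> differentiable F z -> differentiable G z.
Proof.
move=> FG dF; have -> : G = F + (G - F) by rewrite addrC subrK.
apply: differentiableD => //; apply: near0_differentiable.
by apply: filterS FG => y FGy; rewrite !fctE FGy subrr.
Qed.

Lemma near_eq_near_derive (W : normedModType R) (F G : V -> W) (v z : V) :
  (\forall y \near z, F y = G y) ->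
  \forall y \near z, 'D_v F y = 'D_v G y.
Proof.
by move=> /near_near; apply: filterS => y; exact: near_eq_derive.
Qed.

Lemma Ck_near_differentiable (W : normedModType R) k (F : V -> W) (z : V) :
  Ck k F z -> \forall y \near z, differentiable F y.
Proof. by case: k => [|k] []. Qed.

Lemma Ck_differentiable (W : normedModType R) k (F : V -> W) (z : V) :
  Ck k F z -> differentiable F z.
Proof. by move/Ck_near_differentiable/nbhs_singleton. Qed.

Lemma Ck_continuous (W : normedModType R) k (F : V -> W) (z : V) :
  Ck k F z -> {for z, continuous F}.
Proof. by move/Ck_differentiable/differentiable_continuous. Qed.

Lemma Ck_near (W : normedModType R) k (F : V -> W) (z : V) (P : W -> Prop) :
  Ck k F z -> (\forall y \near F z, P y) -> \forall y \near z, P (F y).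
Proof. by move=> /Ck_continuous; exact. Qed.

Lemma Ck_derivable (W : normedModType R) k (F : V -> W) (z v : V) :
  Ck k F z -> derivable F z v.
Proof. by move/Ck_differentiable/diff_derivable. Qed.

Lemma Ck_derive (W : normedModType R) k (F : V -> W) (z v : V) :
  Ck k.+1 F z -> Ck k ('D_v F) z.
Proof. by case=> _; exact. Qed.

Lemma CkW (W : normedModType R) k (F : V -> W) (z : V) :
  Ck k.+1 F z -> Ck k F z.
Proof.
elim: k F => [|k IH] F [dF DF]; split=> // v; exact: (IH _ (DF v)).
Qed.

Lemma smooth_on_Ck (W : normedModType R) k (U : set V) (F : V -> W) (z : V) :
  smooth_on U F -> nbhs z U -> Ck k F z.
Proof.
elim: k F => [|k IH] F sF Uz; split=> //.
- by apply: filterS Uz => y; exact: (sF [::]).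
- by apply: filterS Uz => y; exact: (sF [::]).
(* The direction differentiated first is innermost in the iterated derivative, hence last in the
   list. *)
by move=> v; apply: IH => // vs y /(sF (rcons vs v)); rewrite foldr_rcons.
Qed.

(** Needed because the rules for derivatives of sums, products and composites hold only where the
    constituents are differentiable, that is on a neighbourhood of [z]. *)
Lemma near_eq_Ck (W : normedModType R) k (F G : V -> W) (z : V) :
  (\forall y \near z, F y = G y) -> Ck k F z -> Ck k G z.
Proof.
elim: k F G => [|k IH] F G FG [dF DF]; split=> //.
- apply: filterS2 (near_near FG) dF => y; exact: near_eq_differentiable.
- apply: filterS2 (near_near FG) dF => y; exact: near_eq_differentiable.
by move=> v; apply: IH (DF v); exact: near_eq_near_derive.
Qed.

Lemma Ck_cst (W : normedModType R) k (a : W) (z : V) : Ck k (cst a) z.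
Proof.
elim: k a => [|k IH] a; split=> //; try by near=> y; exact: differentiable_cst.
by move=> v; rewrite (_ : 'D_v (cst a) = cst 0) //; apply/funext => y;
  exact: derive_cst.
Unshelve. all: by end_near. Qed.

Lemma CkD (W : normedModType R) k (F G : V -> W) (z : V) :
  Ck k F z -> Ck k G z -> Ck k (F + G) z.
Proof.
elim: k F G => [|k IH] F G [dF DF] [dG DG]; split=> //.
- by apply: filterS2 dF dG => y; exact: differentiableD.
- by apply: filterS2 dF dG => y; exact: differentiableD.
move=> v; apply: near_eq_Ck (IH _ _ (DF v) (DG v)).
by apply: filterS2 dF dG => y dF dG; rewrite deriveD//; exact: diff_derivable.
Qed.

Lemma CkN (W : normedModType R) k (F : V -> W) (z : V) :
  Ck k F z -> Ck k (- F) z.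
Proof.
elim: k F => [|k IH] F [dF DF]; split=> //.
- by apply: filterS dF => y; exact: differentiableN.
- by apply: filterS dF => y; exact: differentiableN.
move=> v; apply: near_eq_Ck (IH _ (DF v)).
by apply: filterS dF => y dF; rewrite deriveN//; exact: diff_derivable.
Qed.

Lemma CkM k (F G : V -> R) (z : V) : Ck k F z -> Ck k G z -> Ck k (F * G) z.
Proof.
elim: k F G => [|k IH] F G FS GS.
  have [[dF _] [dG _]] := (FS, GS).
  by split=> //; apply: filterS2 dF dG => y; exact: differentiableM.
have [[dF DF] [dG DG]] := (FS, GS); split.
  by apply: filterS2 dF dG => y; exact: differentiableM.
(* The product rule leaves one factor undifferentiated, with one order more than the induction
   hypothesis asks for; [CkW] lowers it. *)
move=> v; apply: near_eq_Ck (CkD (IH _ _ (CkW FS) (DG v)) (IH _ _ (CkW GS) (DF v))).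
by apply: filterS2 dF dG => y dF dG; rewrite deriveM//; exact: diff_derivable.
Qed.

Lemma Ck_sum (W : normedModType R) k (I : Type) (r : seq I) (F : I -> V -> W)
    (z : V) :
  (forall i, Ck k (F i) z) -> Ck k (fun y => \sum_(i <- r) F i y) z.
Proof.
move=> FS; elim: r => [|i r IH].
  by under eq_fun do rewrite big_nil; exact: Ck_cst.
by under eq_fun do rewrite big_cons; exact: CkD.
Qed.

Lemma Ck_id k (y : V) : Ck k id y.
Proof.
case: k => [|k]; split=> //; try by apply: nearW => t; exact: ex_diff.
move=> v; rewrite (_ : 'D_v id = cst v); first exact: Ck_cst.
by apply/funext => t; exact: derive_id.
Qed.

Lemma near_Ck0 (W : normedModType R) k (F : V -> W) (z : V) :
  Ck k F z -> \forall y \near z, Ck 0 F y.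
Proof.
move/Ck_near_differentiable/near_near; apply: filterS => y dF.
by split.
Qed.

End Ck.

(** * Row-vector valued maps and the chain rule to second order *)

Section rowvec.
Variables (R : realType) (V : normedModType R) (m : nat).

Lemma rV_sum_basis (a : 'rV[R]_m) : a = \sum_i a 0 i *: basis_vec R i.
Proof. exact: row_sum_delta. Qed.

Lemma CkZl (W : normedModType R) k (F : V -> R) (w : W) (z : V) :
  Ck k F z -> Ck k (fun y => F y *: w) z.
Proof.
elim: k F => [|k IH] F [dF DF]; split=> //.
- by apply: filterS dF => y; exact: differentiableZl.
- by apply: filterS dF => y; exact: differentiableZl.
move=> v; apply: near_eq_Ck (IH _ (DF v)).
apply: filterS dF => y dF; rewrite [RHS]deriveE; last exact: differentiableZl.
by rewrite diffZl// deriveE.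
Qed.

Lemma Ck_rV k (F : V -> 'rV[R]_m) (z : V) :
  (forall i, Ck k (fun y => F y 0 i) z) -> Ck k F z.
Proof.
move=> FS; rewrite (_ : F = fun y => \sum_i F y 0 i *: basis_vec R i).
  by apply: Ck_sum => i; exact: CkZl.
by apply/funext => y; exact: rV_sum_basis.
Qed.

Lemma derive_coord (F : V -> 'rV[R]_m) (z v : V) i :
  derivable F z v -> ('D_v F z) 0 i = 'D_v (fun y => F y 0 i) z.
Proof. by move=> dF; rewrite derive_mx // mxE. Qed.

Lemma Ck_coord k (F : V -> 'rV[R]_m) (z : V) i :
  Ck k F z -> Ck k (fun y => F y 0 i) z.
Proof.
have dcoord (G : V -> 'rV[R]_m) y : differentiable G y ->
    differentiable (fun y => G y 0 i) y.
  move=> dG; apply: (@differentiable_comp _ _ _ _ G (fun M => M 0 i)) => //.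
  exact: differentiable_coord.
elim: k F => [|k IH] F [dF DF]; split=> //.
- by apply: filterS dF => y; exact: dcoord.
- by apply: filterS dF => y; exact: dcoord.
move=> v; apply: near_eq_Ck (IH _ (DF v)).
by apply: filterS dF => y dF; rewrite derive_coord//; exact: diff_derivable.
Qed.

Lemma derive_comp (W : normedModType R) (F : V -> 'rV[R]_m)
    (G : 'rV[R]_m -> W) (z v : V) :
  differentiable F z -> differentiable G (F z) ->
  'D_v (G \o F) z = 'D_('D_v F z) G (F z).
Proof.
move=> dF dG; rewrite deriveE; last exact: differentiable_comp.
by rewrite diff_comp//= !deriveE.
Qed.

Lemma derive_sum_basis (G : 'rV[R]_m -> R) (a y : 'rV[R]_m) :
  differentiable G y ->
  'D_a G y = \sum_i a 0 i * 'D_(basis_vec R i) G y.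
Proof.
move=> dG; rewrite deriveE// {1}(rV_sum_basis a) linear_sum.
by apply: eq_bigr => i _; rewrite linearZ deriveE.
Qed.

Lemma near_comp_differentiable k (F : V -> 'rV[R]_m) (G : 'rV[R]_m -> R)
    (z : V) :
  Ck k F z -> Ck k G (F z) ->
  \forall y \near z, differentiable F y /\ differentiable G (F y).
Proof.
move=> FS GS; have /= := Ck_continuous FS (Ck_near_differentiable GS).
exact: filterS2 (Ck_near_differentiable FS).
Qed.

Lemma derive_comp_sum (F : V -> 'rV[R]_m) (G : 'rV[R]_m -> R) (y v : V) :
  differentiable F y -> differentiable G (F y) ->
  'D_v (G \o F) y =
  \sum_i 'D_v (fun x => F x 0 i) y * 'D_(basis_vec R i) G (F y).
Proof.
move=> dF dG; rewrite derive_comp// derive_sum_basis//.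
by apply: eq_bigr => i _; rewrite derive_coord//; exact: diff_derivable.
Qed.

(** Induction on [k]: the chain rule in coordinates turns the derivative of [G \o F] into a sum of
    products of derivatives of coordinates of [F] with composites of the same kind, whose outer map
    is a partial derivative of [G]. *)
Lemma Ck_comp k (F : V -> 'rV[R]_m) (G : 'rV[R]_m -> R) (z : V) :
  Ck k F z -> Ck k G (F z) -> Ck k (G \o F) z.
Proof.
elim: k G => [|k IH] G FS GS.
  split=> //; apply: filterS (near_comp_differentiable FS GS) => y [dF dG].
  exact: differentiable_comp.
split.
  apply: filterS (near_comp_differentiable FS GS) => y [dF dG].
  exact: differentiable_comp.
move=> v.
apply: (@near_eq_Ck _ _ _ _ (fun y =>
    \sum_i 'D_v (fun x => F x 0 i) y * 'D_(basis_vec R i) G (F y))).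
  apply: filterS (near_comp_differentiable FS GS) => y [dF dG].
  by rewrite derive_comp_sum.
apply: Ck_sum => i; apply: CkM; first exact/Ck_derive/Ck_coord.
by apply: (IH ('D_(basis_vec R i) G)); [exact: CkW|exact: Ck_derive].
Qed.

(** Obtained by differentiating the chain rule once more. The direction [a] is frozen at its value
    at [z], so the variation of the velocity of [F] appears as the separate second term. *)
Lemma derive2_comp (F : V -> 'rV[R]_m) (G : 'rV[R]_m -> R) (z v : V) :
  Ck 1 F z -> Ck 1 G (F z) ->
  let a := 'D_v F z in
  'D_v ('D_v (G \o F)) z = 'D_a ('D_a G) (F z) + 'D_('D_v ('D_v F) z) G (F z).
Proof.
move=> FS GS a.
rewrite (@near_eq_derive _ _ _ _ (fun y =>
    \sum_i 'D_v (fun x => F x 0 i) y * 'D_(basis_vec R i) G (F y))); last first.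
  apply: filterS (near_comp_differentiable FS GS) => y [dF dG].
  by rewrite derive_comp_sum.
have aE : \forall y \near F z,
    'D_a G y = \sum_i a 0 i * 'D_(basis_vec R i) G y.
  by apply: filterS (Ck_near_differentiable GS) => y dG; exact: derive_sum_basis.
rewrite (near_eq_derive _ aE) (derive_sum_basis _ (Ck_differentiable GS)).
have dF i : Ck 0 ('D_v (fun x => F x 0 i)) z by exact/Ck_derive/Ck_coord.
have dG i : Ck 0 ('D_(basis_vec R i) G \o F) z.
  by apply: Ck_comp; [exact: CkW|exact: Ck_derive].
rewrite (_ : (fun y => _) = \sum_i
    'D_v (fun x => F x 0 i) * ('D_(basis_vec R i) G \o F)); last first.
  by apply/funext => y; rewrite fct_sumE.
rewrite derive_sum; last first.
  by move=> i; apply: derivableM; [exact: Ck_derivable (dF i)|exact: Ck_derivable (dG i)].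
rewrite [X in _ = 'D_a X _ + _](_ : _ = \sum_i
    (a 0 i *: 'D_(basis_vec R i) G)); last first.
  by apply/funext => y; rewrite fct_sumE.
rewrite derive_sum; last first.
  by move=> i; apply: derivableZ; apply: Ck_derivable; apply: Ck_derive GS.
rewrite -big_split; apply: eq_bigr => i _ /=.
rewrite deriveM; [|exact: Ck_derivable (dF i)|exact: Ck_derivable (dG i)].
rewrite deriveZ; last by apply: Ck_derivable; apply: Ck_derive GS.
rewrite derive_comp; [|exact: Ck_differentiable FS|]; last first.
  by apply: Ck_differentiable; apply: Ck_derive GS.
rewrite -derive_coord; last exact: Ck_derivable FS.
congr (_ + _); rewrite mulrC; congr (_ * _).
rewrite derive_coord; last by apply: Ck_derivable; apply: Ck_derive FS.
apply: near_eq_derive; apply: filterS (Ck_near_differentiable FS) => y dFy.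
by rewrite derive_coord//; exact: diff_derivable.
Qed.

End rowvec.

(** * The mean value theorem and the symmetry of mixed derivatives *)

Section schwarz.
Variables (R : realType) (V : normedModType R).

Lemma line_MVT (G : V -> R) (z w : V) (h : R) : 0 < h ->
  (forall s, 0 <= s <= h -> differentiable G (z + s *: w)) ->
  exists2 c, 0 <= c <= h & G (z + h *: w) - G z = h * 'D_w G (z + c *: w).
Proof.
move=> h0 dG; pose g := G \o (fun s : R^o => z + s *: w).
have gE (s : R) : 0 <= s <= h -> is_derive (s : R^o) 1 g ('D_w G (z + s *: w)).
  move=> /dG dGs; pose l := fun s : R^o => z + s *: w.
  have dl : is_diff (s : R^o) l (fun t => t *: w).
    by apply: is_diff_eq (add0r _).
  have dgs : differentiable g s by exact: differentiable_comp.
  apply: DeriveDef; first exact: diff_derivable.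
  rewrite deriveE// diff_comp//= [X in 'd G _ (X _)]diff_val scale1r.
  by rewrite deriveE.
have gc s : 0 <= s <= h -> {for s, continuous g}.
  by move=> /gE[+ _] => /derivable1_diffP/differentiable_continuous.
have [s||c + cE] := @MVT R g (fun s => 'D_w G (z + s *: w)) 0 h h0.
- by rewrite in_itv/= => /andP[s0 sh]; apply: gE; rewrite !ltW.
- apply: continuous_in_subspaceT => s; rewrite inE/= in_itv/=; exact: gc.
rewrite in_itv/= => /andP[c0 ch]; exists c; first by rewrite !ltW.
by move: cE; rewrite /g /= scale0r addr0 subr0 mulrC.
Qed.

(** Two uses of the mean value theorem: along [u] for the increment of [F] by [h *: v], then along
    [v] for ['D_u F]. *)
Lemma second_difference (F : V -> R) (z u v : V) (h : R) : 0 < h ->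
  (forall a b, 0 <= a <= h -> 0 <= b <= h ->
     differentiable F (z + a *: u + b *: v) /\
     differentiable ('D_u F) (z + a *: u + b *: v)) ->
  exists a b, [/\ 0 <= a <= h, 0 <= b <= h &
    F (z + h *: u + h *: v) - F (z + h *: u) - (F (z + h *: v) - F z) =
    h * (h * 'D_v ('D_u F) (z + a *: u + b *: v))].
Proof.
move=> h0 dF; pose S := fun y : V => y + h *: v.
have dS y : is_diff y S id by apply: is_diff_eq (addr0 _).
have hh : 0 <= h <= h by rewrite ltW/=.
have h00 : 0 <= (0:R) <= h by apply/andP; split=> //; exact: ltW.
have dFS a : 0 <= a <= h -> differentiable (F \o S) (z + a *: u).
  by move=> ah; apply: differentiable_comp => //; exact: (dF a h ah hh).1.
have dF0 a : 0 <= a <= h -> differentiable F (z + a *: u).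
  by move=> ah; have [] := dF a 0 ah h00; rewrite scale0r addr0.
have [|a ah aE] := @line_MVT (F \o S - F) z u h h0.
  by move=> a ah; apply: differentiableB; [exact: dFS|exact: dF0].
have [|b bh bE] := @line_MVT ('D_u F) (z + a *: u) v h h0.
  by move=> b bh; exact: (dF a b ah bh).2.
exists a, b; split=> //; rewrite -bE.
rewrite -[LHS]/((F \o S - F) (z + h *: u) - (F \o S - F) z) aE.
congr (_ * _).
rewrite deriveB; [|exact/diff_derivable/dFS|exact/diff_derivable/dF0].
congr (_ - _); rewrite [LHS]deriveE; last exact: dFS.
rewrite diff_comp//; last exact: (dF a h ah hh).1.
by rewrite /= diff_val [RHS]deriveE//; exact: (dF a h ah hh).1.
Qed.

Lemma near_norm_lt (z : V) (P : V -> Prop) : (\forall y \near z, P y) ->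
  exists2 r : R, 0 < r & forall y, `|z - y| < r -> P y.
Proof. by move=> /nbhs_normP[r r0 zr]; exists r. Qed.

(* Both mixed derivatives are, up to e / 2, the second difference of F divided
   by h ^ 2, for h small. *)
Lemma derive_comm (F : V -> R) (z u v : V) : Ck 2 F z ->
  'D_u ('D_v F) z = 'D_v ('D_u F) z.
Proof.
move=> FS; apply/eqP; rewrite -subr_eq0 -normr_le0.
suff le_e (e : R) : 0 < e ->
    `|'D_u ('D_v F) z - 'D_v ('D_u F) z| <= e.
  by apply/ler_addgt0Pl => e e0; rewrite addr0; exact: le_e.
move=> e0.
have e2 : 0 < e / 2 by rewrite divr_gt0.
have closeN (G : V -> R) : {for z, continuous G} ->
    \forall y \near z, `|G z - G y| <= e / 2.
  by move=> /cvgrPdist_le; exact.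
have nuv := closeN _ (Ck_continuous (Ck_derive u (Ck_derive v FS))).
have nvu := closeN _ (Ck_continuous (Ck_derive v (Ck_derive u FS))).
have dF := Ck_near_differentiable FS.
have dDu := Ck_near_differentiable (Ck_derive u FS).
have dDv := Ck_near_differentiable (Ck_derive v FS).
have n1 : \forall y \near z,
    `|'D_u ('D_v F) z - 'D_u ('D_v F) y| <= e / 2 /\
    `|'D_v ('D_u F) z - 'D_v ('D_u F) y| <= e / 2.
  by apply: filterS2 nuv nvu => y yuv yvu; exact: conj yuv yvu.
have n2 : \forall y \near z, [/\ differentiable F y,
    differentiable ('D_u F) y & differentiable ('D_v F) y].
  by apply: filterS3 dF dDu dDv => y d0 du dv; exact: And3 d0 du dv.
have [r1 r10 zr1] := near_norm_lt n1.
have [r2 r20 zr2] := near_norm_lt n2.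
pose r := Num.min r1 r2.
have r0 : 0 < r by rewrite lt_min r10.
have zr y : `|z - y| < r ->
    (`|'D_u ('D_v F) z - 'D_u ('D_v F) y| <= e / 2 /\
     `|'D_v ('D_u F) z - 'D_v ('D_u F) y| <= e / 2) /\
    [/\ differentiable F y, differentiable ('D_u F) y
      & differentiable ('D_v F) y].
  by rewrite lt_min => /andP[/zr1 h1 /zr2 h2]; exact: conj h1 h2.
(* Small enough for the whole parallelogram spanned by [h *: u] and [h *: v] to stay within [r] of
   [z]; the summand 1 keeps the denominator positive when [u] and [v] vanish. *)
pose h := r / (`|u| + `|v| + 1).
have d0 : 0 < `|u| + `|v| + 1 by rewrite ltr_wpDl// addr_ge0.
have h0 : 0 < h by rewrite divr_gt0.
have inr a b : 0 <= a <= h -> 0 <= b <= h -> `|z - (z + a *: u + b *: v)| < r.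
  move=> /andP[a0 ah] /andP[b0 bh]; rewrite opprD addrA.
  rewrite opprD addrA subrr sub0r -opprD normrN.
  apply: (le_lt_trans (ler_normD _ _)); rewrite !normrZ !ger0_norm//.
  apply: (@le_lt_trans _ _ (h * (`|u| + `|v|))).
    by rewrite mulrDr lerD// ler_wpM2r.
  by rewrite /h -mulrA gtr_pMr// mulrC ltr_pdivrMr// mul1r ltrDl.
have inr' a b : 0 <= a <= h -> 0 <= b <= h -> `|z - (z + b *: v + a *: u)| < r.
  by move=> ah bh; rewrite addrAC; exact: inr.
have [|a [b [ah bh abE]]] := @second_difference F z u v h h0.
  move=> a b ah bh; have [_ [d du dv]] := zr _ (inr a b ah bh).
  exact: conj d du.
have [|b' [a' [bh' ah' abE']]] := @second_difference F z v u h h0.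
  move=> b1 a1 bh1 ah1; have [_ [d du dv]] := zr _ (inr' a1 b1 ah1 bh1).
  exact: conj d dv.
have [[_ n4] _] := zr _ (inr a b ah bh).
have [[n3 _] _] := zr _ (inr' a' b' ah' bh').
have E : 'D_v ('D_u F) (z + a *: u + b *: v) =
    'D_u ('D_v F) (z + b' *: v + a' *: u).
  have hn0 : h != 0 by rewrite gt_eqF.
  have hhI (X Y : R) : h * (h * X) = h * (h * Y) -> X = Y.
    by move=> /(mulfI hn0)/(mulfI hn0).
  apply: hhI; apply: etrans (esym abE) (etrans _ abE').
  by rewrite (addrAC z (h *: v)); ring.
rewrite (splitr e) -(subrKA ('D_u ('D_v F) (z + b' *: v + a' *: u))).
apply: (le_trans (ler_normD _ _)); apply: lerD; first exact: n3.
by rewrite -E distrC; exact: n4.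
Qed.

End schwarz.

(** * Regularity of determinants and inverse matrices *)

Section inverse_matrix.
Variables (R : realType) (V : normedModType R).

Lemma Ck_prod k (I : Type) (r : seq I) (F : I -> V -> R) (z : V) :
  (forall i, Ck k (F i) z) -> Ck k (fun y => \prod_(i <- r) F i y) z.
Proof.
move=> FS; elim: r => [|i r IH].
  by under eq_fun do rewrite big_nil; exact: Ck_cst.
by under eq_fun do rewrite big_cons; exact: CkM.
Qed.

Lemma Ck_det k (m : nat) (A : V -> 'M[R]_m) (z : V) :
  (forall i j, Ck k (fun y => A y i j) z) -> Ck k (fun y => \det (A y)) z.
Proof.
move=> AS; apply: Ck_sum => s; apply: CkM; first exact: Ck_cst.
by apply: Ck_prod => i; exact: AS.
Qed.

Lemma Ck_adj k (m : nat) (A : V -> 'M[R]_m) (z : V) i j :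
  (forall i j, Ck k (fun y => A y i j) z) ->
  Ck k (fun y => (\adj (A y)) i j) z.
Proof.
move=> AS; under eq_fun do rewrite mxE /cofactor.
apply: CkM; first exact: Ck_cst.
apply: (@Ck_det k _ (fun y => row' j (col' i (A y)))) => a b.
by under eq_fun do rewrite !mxE; exact: AS.
Qed.

Lemma Ck_neq0 k (f : V -> R) (z : V) :
  Ck k f z -> f z != 0 -> \forall y \near z, f y != 0.
Proof.
move=> fS fz; have : nbhs (f z) [set x | x != 0].
  by apply: open_nbhs_nbhs; split=> //; exact: open_neq.
by move/(Ck_continuous fS).
Qed.

Lemma Ck0V (f : V -> R) (z : V) :
  Ck 0 f z -> f z != 0 -> Ck 0 (fun y => (f y)^-1) z.
Proof.
move=> fS fz; split=> //.
apply: filterS2 (Ck_near_differentiable fS) (Ck_neq0 fS fz) => y; exact: differentiableV.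
Qed.

(** The determinant stays nonzero near [z], and there [invmx] is the adjugate divided by the
    determinant, not its default value on singular matrices. *)
Lemma Ck0_invmx (m : nat) (A : V -> 'M[R]_m) (z : V) i j :
  (forall i j, Ck 0 (fun y => A y i j) z) -> A z \in unitmx ->
  Ck 0 (fun y => invmx (A y) i j) z.
Proof.
move=> AS Az; have dS := Ck_det AS.
have dz : \det (A z) != 0 by rewrite -unitfE -unitmxE.
apply: (@near_eq_Ck _ _ _ _ (fun y => (\det (A y))^-1 * (\adj (A y)) i j)).
  apply: filterS (Ck_neq0 dS dz) => y dy.
  by rewrite /invmx unitmxE unitfE dy [RHS]mxE.
apply: CkM; first exact: Ck0V.
exact: Ck_adj.
Qed.

End inverse_matrix.

(** * The Koszul formula for constant vector fields *)

Section koszul.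
Variables (R : realType) (m : nat) (h : form_field R m).
Hypothesis hE : forall z v w,
  h z v w = \sum_(j < m) \sum_(l < m) v 0 j * w 0 l * gram h z j l.

(** For fields with constant components [a] and [b] this is the whole covariant derivative of [b]
    along [a]. *)
Definition christoffel_vec (G : christoffel_symbols R m) (a b z : 'rV[R]_m) :
  'rV[R]_m := \row_k \sum_(i < m) \sum_(j < m) G i j k z * a 0 i * b 0 j.

(** The inverse Gram matrix in [levi_civita] raises the last index; contracting with the Gram matrix
    undoes it. *)
Lemma levi_civita_lower (z : 'rV[R]_m) i j l : gram h z \in unitmx ->
  \sum_k levi_civita h i j k z * gram h z k l =
  2^-1 * (partial i (fun w => gram h w j l) z
          + partial j (fun w => gram h w i l) z
          - partial l (fun w => gram h w i j) z).
Proof.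
move=> hU; pose r : 'rV_m := \row_l (2^-1 *
  (partial i (fun w => gram h w j l) z + partial j (fun w => gram h w i l) z
   - partial l (fun w => gram h w i j) z)).
have -> : \sum_k levi_civita h i j k z * gram h z k l =
          (r *m invmx (gram h z) *m gram h z) 0 l.
  rewrite mxE; apply: eq_bigr => k _; congr (_ * _).
  by rewrite mxE; apply: eq_bigr => a _; rewrite mxE.
by rewrite -mulmxA mulVmx // mulmx1 mxE.
Qed.

Lemma Ck_form k (v w z : 'rV[R]_m) :
  (forall i j, Ck k (fun y => gram h y i j) z) -> Ck k (fun y => h y v w) z.
Proof.
move=> hS; under eq_fun do rewrite hE.
apply: Ck_sum => j; apply: Ck_sum => l.
by apply: CkM; [exact: Ck_cst|exact: hS].
Qed.

Lemma derive_form (v w a z : 'rV[R]_m) :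
  (forall i j, Ck 0 (fun y => gram h y i j) z) ->
  'D_a (fun y => h y v w) z =
  \sum_(i < m) \sum_(j < m) \sum_(l < m)
    a 0 i * v 0 j * w 0 l * partial i (fun y => gram h y j l) z.
Proof.
move=> hS; rewrite derive_sum_basis; last exact/Ck_differentiable/Ck_form.
apply: eq_bigr => i _.
rewrite (_ : (fun y => _) = \sum_j \sum_l
    ((v 0 j * w 0 l) *: (fun y => gram h y j l))); last first.
  apply/funext => y; rewrite hE fct_sumE; apply: eq_bigr => j _.
  by rewrite fct_sumE.
have dg j l : derivable (fun y => gram h y j l) z (basis_vec R i).
  exact: Ck_derivable (hS j l).
rewrite derive_sum; last first.
  by move=> j; apply: derivable_sum => l; exact: derivableZ.
rewrite mulr_sumr; apply: eq_bigr => j _.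
rewrite derive_sum; last by move=> l; exact: derivableZ.
rewrite mulr_sumr; apply: eq_bigr => l _.
by rewrite deriveZ// /GRing.scale/= !mulrA.
Qed.

(** The bracket terms of the general Koszul formula are absent because the fields are constant; what
    is left is [levi_civita_lower] contracted with the three vectors. *)
Lemma koszul (a b c z : 'rV[R]_m) :
  (forall i j, Ck 0 (fun y => gram h y i j) z) -> gram h z \in unitmx ->
  2 * h z (christoffel_vec (levi_civita h) a b z) c =
  'D_a (fun y => h y b c) z + 'D_b (fun y => h y a c) z
  - 'D_c (fun y => h y a b) z.
Proof.
move=> hS hU.
pose T (P : 'I_m -> 'I_m -> 'I_m -> R) := \sum_(i < m) \sum_(j < m) \sum_(l < m)
  a 0 i * b 0 j * c 0 l * P i j l.
transitivity (T (fun i j l => partial i (fun w => gram h w j l) z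
   + partial j (fun w => gram h w i l) z - partial l (fun w => gram h w i j) z)).
  rewrite hE exchange_big /= mulr_sumr.
  transitivity (\sum_l \sum_i \sum_j a 0 i * b 0 j * c 0 l *
    (2 * \sum_k levi_civita h i j k z * gram h z k l)); last first.
    rewrite exchange_big; apply: eq_bigr => i _; rewrite exchange_big /=.
    apply: eq_bigr => j _; apply: eq_bigr => l _.
    by rewrite levi_civita_lower// mulVKf// pnatr_eq0.
  apply: eq_bigr => l _; rewrite mulr_sumr.
  under eq_bigr => k _ do rewrite mxE !mulr_suml mulr_sumr.
  rewrite exchange_big; apply: eq_bigr => i _.
  under eq_bigr => k _ do rewrite !mulr_suml mulr_sumr.
  rewrite exchange_big; apply: eq_bigr => j _ /=.
  by rewrite !mulr_sumr; apply: eq_bigr => k _; ring.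
have -> : 'D_b (fun y => h y a c) z =
    T (fun i j l => partial j (fun w => gram h w i l) z).
  rewrite derive_form// exchange_big; apply: eq_bigr => i _.
  apply: eq_bigr => j _; apply: eq_bigr => l _.
  by congr (_ * _ * _); exact: mulrC.
have -> : 'D_c (fun y => h y a b) z =
    T (fun i j l => partial l (fun w => gram h w i j) z).
  rewrite derive_form// exchange_big; apply: eq_bigr => i _.
  rewrite exchange_big; apply: eq_bigr => j _; apply: eq_bigr => l _.
  by congr (_ * _); rewrite -mulrA mulrC.
rewrite derive_form// /T -big_split -sumrB; apply: eq_bigr => i _.
rewrite -big_split -sumrB; apply: eq_bigr => j _.
rewrite -big_split -sumrB; apply: eq_bigr => l _ /=.
by rewrite mulrBr mulrDr.
Qed.

End koszul.


(** * The metric [h] of a cost function in coordinates *)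

Section cost_form.
Variables (R : realType) (n : nat) (E : 'rV[R]_(n + n) -> R).
Local Notation Lv a := (row_mx a 0).
Local Notation Rv b := (row_mx 0 b).
Local Notation C := (fun a b => E (row_mx a b)).

(** Both sides are limits of the same difference quotient. *)
Lemma derive_row_mxl (F : 'rV[R]_(n + n) -> R) (a b v : 'rV[R]_n) :
  'D_v (fun x => F (row_mx x b)) a = 'D_(Lv v) F (row_mx a b).
Proof.
rewrite /derive; set f := fun h : R => _; set g := fun h : R => _.
suff -> : f = g by [].
by apply/funext => t; rewrite /f /g /= scale_row_mx add_row_mx scaler0 add0r.
Qed.

Lemma derive_row_mxr (F : 'rV[R]_(n + n) -> R) (a b v : 'rV[R]_n) :
  'D_v (fun y => F (row_mx a y)) b = 'D_(Rv v) F (row_mx a b).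
Proof.
rewrite /derive; set f := fun h : R => _; set g := fun h : R => _.
suff -> : f = g by [].
by apply/funext => t; rewrite /f /g /= scale_row_mx add_row_mx scaler0 add0r.
Qed.

Lemma cross_hessianE (a b : 'rV[R]_n) i j :
  cross_hessian C a b i j =
  'D_(Lv (basis_vec R i)) ('D_(Rv (basis_vec R j)) E) (row_mx a b).
Proof.
rewrite mxE.
have H : (fun x => partial j (fun y => E (row_mx x y)) b) =
    (fun x => 'D_(Rv (basis_vec R j)) E (row_mx x b)).
  by apply/funext => x; exact: derive_row_mxr.
rewrite H.
exact: (derive_row_mxl ('D_(Rv (basis_vec R j)) E) a b (basis_vec R i)).
Qed.

Definition cost_hessian (z : 'rV[R]_(n + n)) : 'M[R]_n :=
  cross_hessian C (lsubmx z) (rsubmx z).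

(** Written as a matrix product so that the invertible factor [cost_hessian z] can be cancelled. *)
Definition mixed (z : 'rV[R]_(n + n)) (a b : 'rV[R]_n) : R :=
  (a *m cost_hessian z *m b^T) 0 0.

Lemma mixedE z a b :
  mixed z a b = \sum_(i < n) \sum_(j < n) a 0 i * b 0 j * cost_hessian z i j.
Proof.
rewrite /mixed mxE exchange_big; apply: eq_bigr => j _ /=.
rewrite mxE mulr_suml; apply: eq_bigr => i _.
by rewrite [b^T _ _]mxE mulrAC.
Qed.

Lemma derive_Lv_sum (F : 'rV[R]_(n + n) -> R) (a : 'rV[R]_n) z :
  differentiable F z ->
  'D_(Lv a) F z = \sum_i a 0 i * 'D_(Lv (basis_vec R i)) F z.
Proof.
move=> dF; have LvE (d : 'rV[R]_n) : Lv d = d *m row_mx 1%:M 0.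
  by rewrite mul_mx_row mulmx1 mulmx0.
rewrite deriveE// LvE {1}(rV_sum_basis a) mulmx_suml linear_sum.
by apply: eq_bigr => i _; rewrite -scalemxAl linearZ -LvE deriveE.
Qed.

Lemma derive_Rv_sum (F : 'rV[R]_(n + n) -> R) (b : 'rV[R]_n) z :
  differentiable F z ->
  'D_(Rv b) F z = \sum_i b 0 i * 'D_(Rv (basis_vec R i)) F z.
Proof.
move=> dF; have RvE (d : 'rV[R]_n) : Rv d = d *m row_mx 0 1%:M.
  by rewrite mul_mx_row mulmx1 mulmx0.
rewrite deriveE// RvE {1}(rV_sum_basis b) mulmx_suml linear_sum.
by apply: eq_bigr => i _; rewrite -scalemxAl linearZ -RvE deriveE.
Qed.

Lemma mixed_derive (z : 'rV[R]_(n + n)) (a b : 'rV[R]_n) : Ck 1 E z ->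
  mixed z a b = 'D_(Lv a) ('D_(Rv b) E) z.
Proof.
move=> ES; have near_sum : \forall y \near z, 'D_(Rv b) E y =
    (\sum_j (b 0 j *: 'D_(Rv (basis_vec R j)) E)) y.
  apply: filterS (Ck_near_differentiable ES) => y dE.
  by rewrite derive_Rv_sum// fct_sumE.
rewrite (near_eq_derive _ near_sum).
have dR j : Ck 0 ('D_(Rv (basis_vec R j)) E) z by exact: Ck_derive.
rewrite derive_sum; last by move=> j; apply: derivableZ; exact: Ck_derivable (dR j).
rewrite mixedE exchange_big; apply: eq_bigr => j _ /=.
rewrite deriveZ; last exact: Ck_derivable (dR j).
rewrite derive_Lv_sum; last exact: Ck_differentiable (dR j).
rewrite scaler_sumr; apply: eq_bigr => i _.
rewrite /cost_hessian cross_hessianE hsubmxK /GRing.scale /=.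
by rewrite mulrA (mulrC (a 0 i)).
Qed.

(** The Gram matrix of [h]. Its diagonal blocks vanish, and the factor one half comes from
    polarizing the quadratic form. *)
Definition form_mx (z : 'rV[R]_(n + n)) : 'M[R]_(n + n) :=
  (- 2^-1) *: block_mx 0 (cost_hessian z) (cost_hessian z)^T 0.

Lemma h_formE z v w :
  h_form C z v w =
  - (2^-1 * (mixed z (lsubmx v) (rsubmx w) + mixed z (lsubmx w) (rsubmx v))).
Proof.
have qE u : h_quad C z u = - mixed z (lsubmx u) (rsubmx u).
  rewrite /h_quad mixedE; congr (- _).
  by apply: eq_bigr => i _; apply: eq_bigr => j _; rewrite -mulrA mulrC.
have mD (a a' b b' : 'rV[R]_n) : mixed z (a + a') (b + b') =
    mixed z a b + mixed z a b' + (mixed z a' b + mixed z a' b').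
  rewrite /mixed [(b + b')^T]linearD !mulmxDl !mulmxDr.
  by rewrite [LHS]mxE; congr (_ + _); rewrite mxE.
by rewrite /h_form !qE !linearD /= mD; field.
Qed.

Lemma h_form_mx z v w : h_form C z v w = (v *m form_mx z *m w^T) 0 0.
Proof.
rewrite h_formE /form_mx -scalemxAr -scalemxAl [RHS]mxE mulNr; congr (- (_ * _)).
rewrite -{3}(hsubmxK v) mul_row_block !mulmx0 add0r addr0.
rewrite -{3}(hsubmxK w) tr_row_mx mul_row_col mxE addrC /mixed; congr (_ + _).
rewrite -[in LHS](trmxK (_ *m _)) [LHS]mxE trmx_mul trmxK trmx_mul.
by rewrite mulmxA.
Qed.

Lemma gram_h_form z : gram (h_form C) z = form_mx z.
Proof.
apply/matrixP => i j; rewrite mxE h_form_mx -rowE.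
by rewrite /basis_vec trmx_delta -colE !mxE.
Qed.

Lemma h_form_gram z v w :
  h_form C z v w = \sum_j \sum_l v 0 j * w 0 l * gram (h_form C) z j l.
Proof.
rewrite gram_h_form h_form_mx mxE exchange_big; apply: eq_bigr => l _ /=.
by rewrite mxE mulr_suml; apply: eq_bigr => j _; rewrite [w^T _ _]mxE mulrAC.
Qed.

(** An off-diagonal block matrix is inverted by inverting its blocks and exchanging their places. *)
Lemma form_mx_unit z : cost_hessian z \in unitmx -> form_mx z \in unitmx.
Proof.
move=> CU; have := CU; rewrite -unitmx_tr => CUt.
have h2 : - 2^-1 != 0 :> R by rewrite oppr_eq0 invr_eq0 pnatr_eq0.
rewrite /form_mx unitmxZ ?unitfE//.
have : block_mx 0 (cost_hessian z) (cost_hessian z)^T 0 *m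
    block_mx 0 (invmx (cost_hessian z)^T) (invmx (cost_hessian z)) 0 = 1%:M.
  rewrite mulmx_block !mul0mx !mulmx0 !addr0 !add0r !mulmxV//.
  by rewrite -scalar_mx_block.
by case/mulmx1_unit.
Qed.

End cost_form.

(** The right-sided difference quotients at a minimum are nonnegative in every direction; by
    linearity of the differential, using [v] and [- v] leaves only zero. *)
Lemma derive_at_min (R : realType) (V : normedModType R) (F : V -> R) (z v : V) :
  differentiable F z -> (forall y, F z <= F y) -> 'D_v F z = 0.
Proof.
move=> dF Fmin.
have ge0 w : 0 <= 'D_w F z.
  have dw : derivable F z w by exact: diff_derivable.
  rewrite /derive cvg_at_rightE//; apply: limr_ge.
    apply: cvgP; apply: cvg_trans dw; apply: cvg_app => A [e e0 Ae].
    by exists e => // t te t0; apply: (Ae t) => //; exact: lt0r_neq0.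
  near=> t; apply: mulr_ge0; last by rewrite subr_ge0; exact: Fmin.
  by rewrite invr_ge0; apply: ltW; near: t; exact: nbhs_right_gt.
have := ge0 (- v); rewrite !deriveE// linearN -deriveE// oppr_ge0 => le0.
by apply/eqP; rewrite eq_le le0 ge0.
Unshelve. all: by end_near. Qed.

(** The constant cancels already in the difference quotient. This discards the terms of the
    divergence that depend only on the variable held fixed. *)
Lemma derive_subr (R : realType) (V W : normedModType R) (F : V -> W) (c : W)
    (z v : V) : 'D_v (fun y => F y - c) z = 'D_v F z.
Proof.
rewrite /derive; set f := fun h : R => _; set g := fun h : R => _.
suff -> : f = g by [].
by apply/funext => t; rewrite /f /g /= opprB addrA subrK.
Qed.


(* Otherwise failing to unify two distinct derivatives unfolds both to limits,
   which does not end. *)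
#[local] Opaque derive Ck.


(** * Christoffel symbols and curvature of [h] *)

Section cost_curvature.
Variables (R : realType) (n : nat) (E : 'rV[R]_(n + n) -> R).
Local Notation Lv a := (row_mx a 0).
Local Notation Rv b := (row_mx 0 b).
Local Notation C := (fun a b => E (row_mx a b)).
Local Notation h := (h_form C).
Local Notation Gam := (christoffel_vec (levi_civita h)).

Lemma Ck_le (V W : normedModType R) j k (F : V -> W) z :
  (j <= k)%N -> Ck k F z -> Ck j F z.
Proof.
move=> jk; rewrite -(subnK jk); elim: (k - j)%N => // i IH FS.
exact/IH/CkW.
Qed.

Lemma mixed0l z b : mixed E z 0 b = 0.
Proof. by rewrite /mixed !mul0mx mxE. Qed.

Lemma mixed0r z a : mixed E z a 0 = 0.
Proof. by rewrite /mixed trmx0 mulmx0 mxE. Qed.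

Lemma mixed_sumr z a b :
  mixed E z a b = \sum_j b 0 j * mixed E z a (basis_vec R j).
Proof.
rewrite mixedE exchange_big; apply: eq_bigr => j _ /=.
rewrite /mixed trmx_delta -colE mxE mxE mulr_sumr.
by apply: eq_bigr => i _; rewrite mulrCA mulrA.
Qed.

Lemma h_formL z w c : h z w (Lv c) = - (2^-1 * mixed E z c (rsubmx w)).
Proof. by rewrite h_formE row_mxKl row_mxKr mixed0r add0r. Qed.

Lemma h_formR z w c : h z w (Rv c) = - (2^-1 * mixed E z (lsubmx w) c).
Proof. by rewrite h_formE row_mxKl row_mxKr mixed0l addr0. Qed.

Lemma mixed_nondegl z b : cost_hessian E z \in unitmx ->
  (forall a, mixed E z a b = 0) -> b = 0.
Proof.
move=> CU m0; apply: trmx_inj; rewrite trmx0.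
apply: (can_inj (mulKmx CU)); rewrite mulmx0; apply/colP => i.
have := m0 (delta_mx 0 i); rewrite /mixed -mulmxA -rowE mxE => ->.
by rewrite mxE.
Qed.

Lemma mixed_nondegr z a : cost_hessian E z \in unitmx ->
  (forall b, mixed E z a b = 0) -> a = 0.
Proof.
move=> CU m0; apply: (can_inj (mulmxK CU)); rewrite mul0mx; apply/rowP => i.
have := m0 (delta_mx 0 i); rewrite /mixed trmx_delta -colE mxE => ->.
by rewrite mxE.
Qed.

(** Pairing with [(c, 0)] detects the barred part of [w] and pairing with [(0, c)] the unbarred
    part, each through the invertible mixed Hessian. This turns values of the Koszul formula into
    values of Christoffel vectors. *)
Lemma h_form_nondeg z w : cost_hessian E z \in unitmx ->
  (forall c, h z w (Lv c) = 0) -> (forall c, h z w (Rv c) = 0) -> w = 0.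
Proof.
move=> CU hL hR; have half0 (t : R) : - (2^-1 * t) = 0 -> t = 0.
  by move=> /eqP; rewrite oppr_eq0 mulf_eq0 invr_eq0 pnatr_eq0 /= => /eqP.
have r0 : rsubmx w = 0.
  by apply: (mixed_nondegl CU) => a; apply: half0; rewrite -h_formL; exact: hL.
have l0 : lsubmx w = 0.
  by apply: (mixed_nondegr CU) => b; apply: half0; rewrite -h_formR; exact: hR.
by rewrite -(hsubmxK w) r0 l0 row_mx0.
Qed.

Lemma Ck_mixed k z a b : Ck k.+2 E z -> Ck k (fun y => mixed E y a b) z.
Proof.
move=> ES; under eq_fun do rewrite mixedE.
apply: Ck_sum => i; apply: Ck_sum => j; apply: CkM; first exact: Ck_cst.
rewrite (_ : (fun y => _) =
    'D_(Lv (basis_vec R i)) ('D_(Rv (basis_vec R j)) E)); last first.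
  by apply/funext => y; rewrite /cost_hessian cross_hessianE hsubmxK.
exact/Ck_derive/Ck_derive.
Qed.

Lemma Ck_gram k z i j : Ck k.+2 E z -> Ck k (fun y => gram h y i j) z.
Proof.
move=> ES; under eq_fun do rewrite mxE h_formE -mulrN.
apply: CkM; first exact: Ck_cst.
by apply: CkN; apply: CkD; exact: Ck_mixed.
Qed.

Lemma gram_unit z : cost_hessian E z \in unitmx -> gram h z \in unitmx.
Proof. by rewrite gram_h_form; exact: form_mx_unit. Qed.


Lemma koszul_h a b c z : Ck 3 E z -> cost_hessian E z \in unitmx ->
  2 * h z (Gam a b z) c =
  'D_a (fun y => h y b c) z + 'D_b (fun y => h y a c) z
  - 'D_c (fun y => h y a b) z.
Proof.
move=> ES CU; apply: koszul.
- exact: h_form_gram.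
- by move=> i j; apply: Ck_gram; exact: CkW.
- exact: gram_unit.
Qed.

Lemma derive_h_LL a b c z : 'D_c (fun y => h y (Lv a) (Lv b)) z = 0.
Proof.
rewrite (_ : (fun y => _) = cst 0) ?derive_cst//; apply/funext => y.
by rewrite h_formL row_mxKr mixed0r mulr0 oppr0.
Qed.

Lemma derive_h_RR a b c z : 'D_c (fun y => h y (Rv a) (Rv b)) z = 0.
Proof.
rewrite (_ : (fun y => _) = cst 0) ?derive_cst//; apply/funext => y.
by rewrite h_formR row_mxKl mixed0l mulr0 oppr0.
Qed.

Lemma derive_h_RL a b c z : (\forall y \near z, Ck 3 E y) ->
  'D_c (fun y => h y (Rv b) (Lv a)) z =
  - (2^-1 * 'D_c ('D_(Lv a) ('D_(Rv b) E)) z).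
Proof.
move=> EU; have ES := nbhs_singleton EU.
rewrite (@near_eq_derive _ _ _ _ (- (2^-1 *: 'D_(Lv a) ('D_(Rv b) E)))).
  have dd : derivable ('D_(Lv a) ('D_(Rv b) E)) z c.
    by apply: (@Ck_derivable _ _ _ 0); apply/Ck_derive/Ck_derive/CkW.
  by rewrite deriveN; [rewrite deriveZ|exact: derivableZ].
apply: filterS EU => y ESy.
by rewrite h_formL row_mxKr mixed_derive//; apply: Ck_le ESy.
Qed.

Lemma derive_h_LR a b c z : (\forall y \near z, Ck 3 E y) ->
  'D_c (fun y => h y (Lv a) (Rv b)) z =
  - (2^-1 * 'D_c ('D_(Lv a) ('D_(Rv b) E)) z).
Proof.
move=> EU; rewrite -(derive_h_RL a b c EU).
rewrite (_ : (fun y => h y (Lv a) (Rv b)) = (fun y => h y (Rv b) (Lv a)))//.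
by apply/funext => y; rewrite h_formL h_formR row_mxKl row_mxKr.
Qed.

(** Exchanging two derivatives under a third one requires their symmetry on a neighbourhood, not
    only at [z]. *)
Lemma derive_comm_near (F : 'rV[R]_(n + n) -> R) (u v w z : 'rV[R]_(n + n)) :
  (\forall y \near z, Ck 2 F y) ->
  'D_w ('D_u ('D_v F)) z = 'D_w ('D_v ('D_u F)) z.
Proof.
move=> FU; apply: near_eq_derive; apply: filterS FU => y; exact: derive_comm.
Qed.

Lemma near_Ck_derive k (F : 'rV[R]_(n + n) -> R) (v z : 'rV[R]_(n + n)) :
  (\forall y \near z, Ck k.+1 F y) -> \forall y \near z, Ck k ('D_v F) y.
Proof. by apply: filterS => y; exact: Ck_derive. Qed.

Lemma near_Ck_le j k (F : 'rV[R]_(n + n) -> R) (z : 'rV[R]_(n + n)) : (j <= k)%N ->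
  (\forall y \near z, Ck k F y) -> \forall y \near z, Ck j F y.
Proof. by move=> jk; apply: filterS => y; exact: Ck_le. Qed.

(** Against [(c, 0)] or [(0, c)], one Koszul term pairs vectors of the same factor and vanishes,
    while the other two are the same third derivative of [E] with opposite signs. *)
Lemma christoffel_LR a b z : (\forall y \near z, Ck 3 E y) ->
  cost_hessian E z \in unitmx -> Gam (Lv a) (Rv b) z = 0.
Proof.
move=> EU CU; have ES := nbhs_singleton EU.
have EU2 := near_Ck_le (isT : 2 <= 3)%N EU.
have two0 (t : R) : 2 * t = 0 -> t = 0.
  by move=> /eqP; rewrite mulf_eq0 pnatr_eq0 /= => /eqP.
have halfB (t1 t2 : R) : t1 = t2 -> - (2^-1 * t1) - - (2^-1 * t2) = 0.
  by move=> ->; rewrite subrr.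
apply: (h_form_nondeg CU) => c; apply: two0; rewrite koszul_h//.
  rewrite derive_h_RL// derive_h_LL derive_h_LR// addr0; apply: halfB.
  exact: (derive_comm _ _ (Ck_derive _ ES)).
rewrite derive_h_RR derive_h_LR// derive_h_LR// add0r; apply: halfB.
apply: etrans (derive_comm_near _ _ _ EU2) _.
apply: etrans (esym (derive_comm_near _ _ _ EU2)).
exact: (derive_comm _ _ (Ck_derive _ ES)).
Qed.

(** Tested against [(0, c)], every Koszul term pairs two barred vectors, on which [h] is zero. *)
Lemma christoffel_RR_L b z : Ck 3 E z ->
  cost_hessian E z \in unitmx -> lsubmx (Gam (Rv b) (Rv b) z) = 0.
Proof.
move=> ES CU; apply: (mixed_nondegr CU) => c.
have := koszul_h (Rv b) (Rv b) (Rv c) ES CU.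
rewrite !derive_h_RR h_formR addr0 subr0 mulrN mulVKf ?pnatr_eq0// => /eqP.
by rewrite oppr_eq0 => /eqP.
Qed.

(** Tested against [(a, 0)], the Koszul formula has two equal terms and a vanishing one, and the
    factors one half of [h] cancel. *)
Lemma christoffel_RR a b z : (\forall y \near z, Ck 3 E y) ->
  cost_hessian E z \in unitmx ->
  mixed E z a (rsubmx (Gam (Rv b) (Rv b) z)) =
  'D_(Rv b) ('D_(Lv a) ('D_(Rv b) E)) z.
Proof.
move=> EU CU; have := koszul_h (Rv b) (Rv b) (Lv a) (nbhs_singleton EU) CU.
rewrite derive_h_RL// derive_h_RR h_formL subr0 mulrN mulVKf ?pnatr_eq0// => /eqP.
rewrite -opprD eqr_opp => /eqP ->; lra.
Qed.

Lemma christoffel_vec0r (G : christoffel_symbols R (n + n)) a z :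
  christoffel_vec G a 0 z = 0.
Proof.
apply/rowP => k; rewrite !mxE big1// => i _; rewrite big1// => j _.
by rewrite mxE mulr0.
Qed.

(** Constant fields commute and their covariant derivatives are Christoffel vectors, so only the two
    iterated covariant derivatives remain. *)
Lemma curvature_cst (G : christoffel_symbols R (n + n)) a b z :
  curvature G (cst a) (cst b) (cst b) z =
  'D_a (christoffel_vec G b b) z + christoffel_vec G a (christoffel_vec G b b z) z
  - ('D_b (christoffel_vec G a b) z + christoffel_vec G b (christoffel_vec G a b z) z).
Proof.
have covE c d : covariant G (cst c) (cst d) = christoffel_vec G c d.
  by apply/funext => y; rewrite /covariant /= derive_cst add0r.
rewrite /curvature !covE [X in _ - _ - X](_ : _ = 0) ?subr0//.
rewrite /covariant derive_cst add0r; apply/rowP => k; rewrite !mxE.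
rewrite big1// => i _; rewrite big1// => j _.
by rewrite /lie_bracket !derive_cst subrr mxE mulr0 mul0r.
Qed.

Lemma Ck_christoffel a b z : Ck 3 E z -> cost_hessian E z \in unitmx ->
  Ck 0 (Gam a b) z.
Proof.
move=> ES CU; apply: Ck_rV => k; under eq_fun do rewrite mxE.
have gS i j : Ck 1 (fun y => gram h y i j) z by exact: Ck_gram.
apply: Ck_sum => i; apply: Ck_sum => j.
apply: CkM; last exact: Ck_cst.
apply: CkM; last exact: Ck_cst.
apply: Ck_sum => l; apply: CkM.
  apply: CkM; first exact: Ck_cst.
  apply: CkD; last by apply: CkN; exact: (Ck_derive _ (gS i j)).
  by apply: CkD; [exact: (Ck_derive _ (gS j l))|exact: (Ck_derive _ (gS i l))].
by apply: Ck0_invmx; [move=> a' b'; exact: CkW|exact: gram_unit].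
Qed.

(* (0, w) is the covariant derivative of (0, v) along itself at z. At nearby
   points this derivative is (0, W), and the curvature is (0, D_u W); D_u W comes
   from differentiating along (u, 0) the identity characterizing W. *)
Lemma sec_h_form u v w z : (\forall y \near z, Ck 4 E y) ->
  (\forall y \near z, cost_hessian E y \in unitmx) ->
  (forall a, 'D_(Lv a) ('D_(Rv w) E) z =
             'D_(Rv v) ('D_(Lv a) ('D_(Rv v) E)) z) ->
  2 * sec h (cst (Lv u)) (cst (Rv v)) z =
  'D_(Lv u) ('D_(Lv u) ('D_(Rv w) E)) z -
  'D_(Lv u) ('D_(Rv v) ('D_(Lv u) ('D_(Rv v) E))) z.
Proof.
move=> EU CU wP.
have EU3 := near_Ck_le (isT : 3 <= 4)%N EU.
have ES := nbhs_singleton EU3; have CUz := nbhs_singleton CU.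
pose W y := rsubmx (Gam (Rv v) (Rv v) y).
have GE : \forall y \near z, Gam (Rv v) (Rv v) y = Rv (W y).
  apply: filterS2 EU3 CU => y Ey Cy.
  by rewrite -[LHS]hsubmxK christoffel_RR_L.
have wE : W z = w.
  apply/eqP; rewrite -subr_eq0; apply/eqP; apply: (mixed_nondegl CUz) => a.
  rewrite /mixed linearB mulmxBr mxE [X in _ + X]mxE.
  rewrite -/(mixed E z a (W z)) -/(mixed E z a w).
  rewrite christoffel_RR// mixed_derive ?wP ?subrr//.
  exact: Ck_le ES.
have G0 : \forall y \near z, Gam (Lv u) (Rv v) y = cst 0 y.
  by apply: filterS2 (near_near EU3) CU => y Ey Cy; rewrite christoffel_LR.
rewrite /sec curvature_cst (near_eq_derive _ G0) derive_cst.
rewrite (nbhs_singleton G0) christoffel_vec0r addr0 subr0.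
rewrite (nbhs_singleton GE) christoffel_LR// addr0 h_formL.
pose m j y := mixed E y u (basis_vec R j).
have GS := Ck_christoffel (Rv v) (Rv v) ES CUz.
have WE j : (fun y => W y 0 j) = fun y => Gam (Rv v) (Rv v) y 0 (rshift n j).
  by apply/funext => y; rewrite mxE.
have WS j : Ck 0 (fun y => W y 0 j) z by rewrite WE; exact: Ck_coord.
have mS j : Ck 0 (m j) z by apply: Ck_mixed; exact: CkW.
have prodE : \forall y \near z, (\sum_j m j * (fun y => W y 0 j)) y =
    'D_(Rv v) ('D_(Lv u) ('D_(Rv v) E)) y.
  apply: filterS2 (near_near EU3) CU => y Ey Cy.
  by rewrite -christoffel_RR// mixed_sumr fct_sumE; apply: eq_bigr => j _; exact: mulrC.
(* The sum of [prodE] with its coefficients frozen at [w], the value of [W] at [z]. In the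
   difference of the two derivatives along [(u, 0)] only the derivative of [W] survives. *)
have mwE : \forall y \near z, (\sum_j (w 0 j *: m j)) y = 'D_(Lv u) ('D_(Rv w) E) y.
  apply: filterS EU3 => y Ey.
  rewrite -mixed_derive; last exact: Ck_le Ey.
  by rewrite mixed_sumr fct_sumE.
have dm j : derivable (m j) z (Lv u) by exact: Ck_derivable (mS j).
have dW j : derivable (fun y => W y 0 j) z (Lv u) by exact: Ck_derivable (WS j).
apply: etrans (congr2 (fun s t => s - t)
  (near_eq_derive (Lv u) mwE) (near_eq_derive (Lv u) prodE)).
rewrite derive_sum; last by move=> j; exact: derivableZ.
rewrite derive_sum; last by move=> j; exact: derivableM.
under [X in _ = _ - X]eq_bigr => j _ do rewrite deriveM//.
rewrite big_split /= mixed_sumr.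
under [X in _ = X - _]eq_bigr => j _ do rewrite deriveZ//.
rewrite wE opprD addrCA subrr addr0 mulrN mulVKf ?pnatr_eq0//; congr (- _).
apply: eq_bigr => j _; rewrite mulrC; congr (_ * _).
rewrite mxE derive_coord; last exact: Ck_derivable GS.
exact: (congr1 (fun F => 'D_(Lv u) F z) (esym (WE j))).
Qed.

End cost_curvature.

(** * Derivatives of pairs of maps and of linear combinations *)

Section row_mx_curves.
Variables (R : realType) (V : normedModType R) (n1 n2 : nat).

Lemma Ck_row_mx k (a : V -> 'rV[R]_n1) (b : V -> 'rV[R]_n2) (z : V) :
  Ck k a z -> Ck k b z -> Ck k (fun y => row_mx (a y) (b y)) z.
Proof.
move=> aS bS; apply: Ck_rV => i; case: (split_ordP i) => j ->.
  by under eq_fun do rewrite row_mxEl; exact: Ck_coord.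
by under eq_fun do rewrite row_mxEr; exact: Ck_coord.
Qed.

Lemma derive_row_mx (a : V -> 'rV[R]_n1) (b : V -> 'rV[R]_n2) (z v : V) :
  Ck 0 a z -> Ck 0 b z ->
  'D_v (fun y => row_mx (a y) (b y)) z = row_mx ('D_v a z) ('D_v b z).
Proof.
move=> aS bS; apply/rowP => i.
rewrite derive_coord; last exact: Ck_derivable (Ck_row_mx aS bS).
case: (split_ordP i) => j ->.
  rewrite row_mxEl derive_coord; last exact: Ck_derivable aS.
  by under eq_fun do rewrite row_mxEl.
rewrite row_mxEr derive_coord; last exact: Ck_derivable bS.
by under eq_fun do rewrite row_mxEr.
Qed.

Lemma derive2_row_mx (a : V -> 'rV[R]_n1) (b : V -> 'rV[R]_n2) (z v : V) :
  Ck 1 a z -> Ck 1 b z ->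
  'D_v ('D_v (fun y => row_mx (a y) (b y))) z =
  row_mx ('D_v ('D_v a) z) ('D_v ('D_v b) z).
Proof.
move=> aS bS; rewrite -derive_row_mx; [|exact: Ck_derive|exact: Ck_derive].
apply: near_eq_derive; apply: filterS2 (near_Ck0 aS) (near_Ck0 bS) => y.
exact: derive_row_mx.
Qed.

(** Premise and conclusion both hold near the point, which allows a second application for second
    derivatives. *)
Lemma derive_near_sum m (F : V -> R) (G : 'I_m -> V -> R) (a : 'I_m -> R)
    (z v : V) :
  (\forall y \near z, F y = \sum_i a i * G i y) ->
  (forall i, \forall y \near z, differentiable (G i) y) ->
  \forall y \near z, 'D_v F y = \sum_i a i * 'D_v (G i) y.
Proof.
move=> FG dG.
have dG' : \forall y \near z, forall i, differentiable (G i) y.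
  exact: filter_forall.
apply: filterS2 (near_near FG) dG' => y FGy dGy.
rewrite (@near_eq_derive _ _ _ _ (\sum_i (a i *: G i))); last first.
  by apply: filterS FGy => y' ->; rewrite fct_sumE.
have dv i : derivable (G i) y v by exact: diff_derivable.
rewrite derive_sum; last by move=> i; exact: derivableZ.
by apply: eq_bigr => i _; rewrite deriveZ.
Qed.

End row_mx_curves.

(** * Geodesic equations with lowered index *)

Section geodesic_equation.
Variables (R : realType) (n : nat).
Implicit Types (G : 'rV[R]_n -> R) (xi u w : 'rV[R]_n).

Lemma derive2_sum_basis G xi u : Ck 1 G xi ->
  'D_u ('D_u G) xi = \sum_(i < n) \sum_(j < n)
    u 0 i * u 0 j * 'D_(basis_vec R i) ('D_(basis_vec R j) G) xi.
Proof.
move=> GS; have nu : \forall y \near xi,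
    'D_u G y = \sum_j u 0 j * 'D_(basis_vec R j) G y.
  by apply: filterS (Ck_near_differentiable GS) => y; exact: derive_sum_basis.
have dG j : \forall y \near xi, differentiable ('D_(basis_vec R j) G) y.
  exact: Ck_near_differentiable (Ck_derive _ GS).
rewrite (nbhs_singleton (derive_near_sum u nu dG)).
rewrite exchange_big; apply: eq_bigr => j _ /=.
rewrite derive_sum_basis; last exact: nbhs_singleton (dG j).
by rewrite mulr_sumr; apply: eq_bigr => i _; rewrite mulrCA mulrA.
Qed.

Lemma raise_index_geodesic (g : 'rV[R]_n -> 'M[R]_n)
    (L : christoffel_symbols R n) xi u w : g xi \in unitmx ->
  (forall k, w 0 k + \sum_(i < n) \sum_(j < n)
     raise_index g L i j k xi * u 0 i * u 0 j = 0) ->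
  forall m, \sum_k w 0 k * g xi k m +
    \sum_(i < n) \sum_(j < n) L i j m xi * u 0 i * u 0 j = 0.
Proof.
move=> gU geo m.
pose r : 'rV[R]_n :=
  \row_m \sum_(i < n) \sum_(j < n) L i j m xi * u 0 i * u 0 j.
have wr : w + r *m invmx (g xi) = 0.
  apply/rowP => k; rewrite !mxE -[RHS](geo k); congr (_ + _).
  rewrite (eq_bigr (fun l => \sum_(i < n) \sum_(j < n)
    L i j l xi * invmx (g xi) l k * u 0 i * u 0 j)); last first.
    move=> l _; rewrite mxE mulr_suml; apply: eq_bigr => i _.
    by rewrite mulr_suml; apply: eq_bigr => j _; ring.
  rewrite exchange_big; apply: eq_bigr => i _; rewrite exchange_big.
  by apply: eq_bigr => j _; rewrite /raise_index !mulr_suml.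
have : ((w + r *m invmx (g xi)) *m g xi) 0 m = 0 by rewrite wr mul0mx mxE.
by rewrite mulmxDl -mulmxA mulVmx// mulmx1 mxE [X in X + _]mxE [X in _ + X]mxE.
Qed.

(** By the second-order chain rule the conclusion says that every [G m] has zero second derivative
    along a curve with velocity [u] and acceleration [w] at [xi]. Primal and dual geodesics are both
    of this form, for different families [G]. *)
Lemma lowered_geodesic (g : 'rV[R]_n -> 'M[R]_n) (L : christoffel_symbols R n)
    (G : 'I_n -> 'rV[R]_n -> R) xi u w :
  (forall m, Ck 1 (G m) xi) -> g xi \in unitmx ->
  (forall k m, g xi k m = - 'D_(basis_vec R k) (G m) xi) ->
  (forall i j m,
     L i j m xi = - 'D_(basis_vec R i) ('D_(basis_vec R j) (G m)) xi) ->
  (forall k, w 0 k + \sum_(i < n) \sum_(j < n)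
     raise_index g L i j k xi * u 0 i * u 0 j = 0) ->
  forall m, 'D_w (G m) xi + 'D_u ('D_u (G m)) xi = 0.
Proof.
move=> GS gU gE LE /(raise_index_geodesic gU) geo m; apply: oppr_inj.
rewrite oppr0 -[RHS](geo m) opprD.
rewrite derive2_sum_basis// derive_sum_basis; last exact: Ck_differentiable (GS m).
congr (_ + _).
  by rewrite -sumrN; apply: eq_bigr => k _; rewrite gE mulrN.
rewrite -sumrN; apply: eq_bigr => i _; rewrite -sumrN; apply: eq_bigr => j _.
by rewrite LE; ring.
Qed.

(** The equation is linear in the function; this extends it from a family indexed by basis vectors
    to an arbitrary direction. *)
Lemma geodesic_comb (G : 'I_n -> 'rV[R]_n -> R) G0 (b : 'I_n -> R) xi u w :
  (forall m, Ck 1 (G m) xi) ->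
  (\forall y \near xi, G0 y = \sum_m b m * G m y) ->
  (forall m, 'D_w (G m) xi + 'D_u ('D_u (G m)) xi = 0) ->
  'D_w G0 xi + 'D_u ('D_u G0) xi = 0.
Proof.
move=> GS GE eq0.
have dG m := Ck_near_differentiable (GS m).
have dDG m := Ck_near_differentiable (Ck_derive u (GS m)).
rewrite (nbhs_singleton (derive_near_sum w GE dG)).
rewrite (nbhs_singleton (derive_near_sum u (derive_near_sum u GE dG) dDG)).
rewrite -big_split big1//= => m _.
by rewrite -mulrDr eq0 mulr0.
Qed.

End geodesic_equation.

(** * The fourth derivative of the cost along a pair of curves *)

Section fourth_derivative.
Variables (R : realType) (n : nat) (E : 'rV[R]_(n + n) -> R) (xi eta : 'rV[R]_n).
Local Notation Lv a := (row_mx a 0).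
Local Notation Rv b := (row_mx 0 b).
Local Notation z := (row_mx xi eta).

Lemma derive2_curve_r (G : 'rV[R]_(n + n) -> R) (b : R -> 'rV[R]_n) (a : 'rV[R]_n) :
  Ck 1 b 0 -> Ck 1 G (row_mx a (b 0)) ->
  'D_1 ('D_1 (fun t => G (row_mx a (b t)))) 0 =
  'D_(Rv ('D_1 b 0)) ('D_(Rv ('D_1 b 0)) G) (row_mx a (b 0)) +
  'D_(Rv ('D_1 ('D_1 b) 0)) G (row_mx a (b 0)).
Proof.
move=> bS GS; pose F := fun t => row_mx a (b t).
have FS : Ck 1 F 0 by exact: Ck_row_mx (Ck_cst _ _ _) bS.
have FE : 'D_1 F 0 = Rv ('D_1 b 0).
  by rewrite (derive_row_mx _ (Ck_cst _ _ _) (CkW bS)) derive_cst.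
have FFE : 'D_1 ('D_1 F) 0 = Rv ('D_1 ('D_1 b) 0).
  rewrite (derive2_row_mx _ (Ck_cst _ _ _) bS).
  rewrite (_ : 'D_(1 : R) (cst a) = cst 0) ?derive_cst//.
  by apply/funext => t; exact: derive_cst.
by rewrite (derive2_comp _ FS GS) FE FFE.
Qed.

Lemma derive2_curve_l (G : 'rV[R]_(n + n) -> R) (a : R -> 'rV[R]_n) (b : 'rV[R]_n) :
  Ck 1 a 0 -> Ck 1 G (row_mx (a 0) b) ->
  'D_1 ('D_1 (fun t => G (row_mx (a t) b))) 0 =
  'D_(Lv ('D_1 a 0)) ('D_(Lv ('D_1 a 0)) G) (row_mx (a 0) b) +
  'D_(Lv ('D_1 ('D_1 a) 0)) G (row_mx (a 0) b).
Proof.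
move=> aS GS; pose F := fun t => row_mx (a t) b.
have FS : Ck 1 F 0 by exact: Ck_row_mx aS (Ck_cst _ _ _).
have FE : 'D_1 F 0 = Lv ('D_1 a 0).
  by rewrite (derive_row_mx _ (CkW aS) (Ck_cst _ _ _)) derive_cst.
have FFE : 'D_1 ('D_1 F) 0 = Lv ('D_1 ('D_1 a) 0).
  rewrite (derive2_row_mx _ aS (Ck_cst _ _ _)).
  rewrite (_ : 'D_(1 : R) (cst b) = cst 0) ?derive_cst//.
  by apply/funext => t; exact: derive_cst.
by rewrite (derive2_comp _ FS GS) FE FFE.
Qed.

Lemma fourth_derivative (Phi : R -> R -> R) (a b : R -> 'rV[R]_n)
    (k1 k2 : R -> R) :
  (\forall y \near z, Ck 4 E y) -> a 0 = xi -> b 0 = eta ->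
  Ck 1 a 0 -> Ck 1 b 0 -> Ck 1 k2 0 ->
  (\forall s \near 0, \forall t \near 0,
     Phi s t = E (row_mx (a s) (b t)) - k1 s - k2 t) ->
  let v := 'D_1 b 0 in
  let A := 'D_(Rv v) ('D_(Rv v) E) + 'D_(Rv ('D_1 ('D_1 b) 0)) E in
  'D_1 ('D_1 (fun s => 'D_1 ('D_1 (Phi s)) 0)) 0 =
  'D_(Lv ('D_1 a 0)) ('D_(Lv ('D_1 a 0)) A) z + 'D_(Lv ('D_1 ('D_1 a) 0)) A z.
Proof.
move=> EU a0 b0 aS bS kS PhiE v A.
have ES := nbhs_singleton EU.
have AS : Ck 1 A z.
  apply: CkD; first by do 2 apply: Ck_derive; exact: (@Ck_le _ _ _ 3 4 E z isT ES).
  by apply: Ck_derive; exact: (@Ck_le _ _ _ 2 4 E z isT ES).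
have nearE : \forall s \near 0, Ck 4 E (row_mx (a s) (b 0)).
  apply: (@Ck_near _ _ _ 1 (fun s => row_mx (a s) (b 0)) 0 (fun y => Ck 4 E y)).
    exact: Ck_row_mx aS (Ck_cst _ _ _).
  by rewrite a0 b0.
(* The term [k1 s] is constant in [t] and disappears here; [k2] leaves a constant in [s], which the
   outer derivatives remove. *)
have inner : \forall s \near 0,
    'D_1 ('D_1 (Phi s)) 0 = A (row_mx (a s) eta) - 'D_1 ('D_1 k2) 0.
  apply: filterS2 nearE PhiE => s Es PhisE.
  have GS : Ck 1 (fun t => E (row_mx (a s) (b t))) 0.
    apply: (@Ck_comp _ _ _ 1 (fun t => row_mx (a s) (b t)) E).
      exact: Ck_row_mx (Ck_cst _ _ _) bS.
    exact: (@Ck_le _ _ _ 1 4 E _ isT Es).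
  have n1 : \forall t \near 0, 'D_1 (Phi s) t =
      ('D_1 (fun t => E (row_mx (a s) (b t))) - 'D_1 k2) t.
    apply: filterS3 (near_near PhisE) (Ck_near_differentiable GS)
      (Ck_near_differentiable kS) => t PE dG dk.
    pose G1 := (fun t => E (row_mx (a s) (b t))) - k2.
    have PE' : \forall t' \near t, Phi s t' = G1 t' - k1 s.
      by apply: filterS PE => t' ->; rewrite /G1 !fctE addrAC.
    rewrite (near_eq_derive _ PE') derive_subr.
    exact: (deriveB (diff_derivable dG) (diff_derivable dk)).
  rewrite (near_eq_derive _ n1).
  rewrite deriveB; [|exact: Ck_derivable (Ck_derive _ GS)
                    |exact: Ck_derivable (Ck_derive _ kS)].
  have Es1 := @Ck_le _ _ _ 1 4 E _ isT Es.
  by rewrite (derive2_curve_r bS Es1) -b0.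
rewrite (@near_eq_derive _ _ _ _ ('D_1 (fun s => A (row_mx (a s) eta)))); last first.
  apply: filterS (near_near inner) => s sE.
  by rewrite (near_eq_derive _ sE) derive_subr.
by rewrite derive2_curve_l ?a0.
Qed.

End fourth_derivative.

(* Stated apart because lra, run where these steps are needed, would unify all
   the derivatives of the context with each other. *)
Lemma cancel_opp (R : realType) (o q q' r r' : R) :
  o = - q -> q' = q -> r = r' -> r + q' = 0 -> o = r'.
Proof. by move=> -> -> ->; lra. Qed.

Lemma cancel_mixed (R : realType) (d4 lhs Y Y' X0 T T' Z Z' : R) :
  lhs = Y' - X0 -> Y' = - Y -> d4 = (X0 + Y) + (T + Z) ->
  Z + Y = 0 -> T' + Z' = 0 -> T' = T -> Z' = Z -> lhs = - d4.
Proof. by move=> -> -> -> ? ? ? ?; lra. Qed.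


(** * The divergence in coordinates: metric, geodesics and curvature *)

Section divergence.
Variables (R : realType) (n : nat).
Variables (E : 'rV[R]_(n + n) -> R) (F : 'rV[R]_n -> 'rV[R]_n)
  (ph : 'rV[R]_n -> R) (D : 'rV[R]_n -> 'rV[R]_n -> R) (xi : 'rV[R]_n).
Local Notation Lv a := (row_mx a 0).
Local Notation Rv b := (row_mx 0 b).
Local Notation z := (row_mx xi (F xi)).
(** The c-transform of the potential at the image of the point with coordinates [b]. *)
Let kappa b := E (row_mx b (F b)) - ph b.
Hypothesis EU : \forall y \near z, Ck 4 E y.
Hypothesis CU : cost_hessian E z \in unitmx.
Hypothesis FS : Ck 2 F xi.
Hypothesis phS : Ck 2 ph xi.
Hypothesis DE : \forall b \near xi, forall a,
  D a b = E (row_mx a (F b)) - ph a - kappa b.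
Hypothesis Dmin : \forall b \near xi, forall a,
  kappa b <= E (row_mx a (F b)) - ph a.
Hypothesis Finj : forall e, 'D_e F xi = 0 -> e = 0.

Let ES : Ck 4 E z := nbhs_singleton EU.

Lemma Ck_graph : Ck 2 (fun b => row_mx b (F b)) xi.
Proof. exact: Ck_row_mx (Ck_id _ _) FS. Qed.

Lemma Ck_row_l k a (G : 'rV[R]_(n + n) -> R) : Ck k G (row_mx a (F xi)) ->
  Ck k (fun x => G (row_mx x (F xi))) a.
Proof.
move=> GS; apply: (@Ck_comp _ _ _ k (fun x => row_mx x (F xi)) G) => //.
by apply: Ck_row_mx; [exact: Ck_id|exact: Ck_cst].
Qed.

Lemma Ck_row_r k a b (G : 'rV[R]_(n + n) -> R) : Ck k F b ->
  Ck k G (row_mx a (F b)) -> Ck k (fun y => G (row_mx a (F y))) b.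
Proof.
move=> FSb GS; apply: (@Ck_comp _ _ _ k (fun y => row_mx a (F y)) G) => //.
by apply: Ck_row_mx => //; exact: Ck_cst.
Qed.

Lemma derive_row_r a b v (G : 'rV[R]_(n + n) -> R) : Ck 0 F b ->
  differentiable G (row_mx a (F b)) ->
  'D_v (fun y => G (row_mx a (F y))) b =
  'D_(Rv ('D_v F b)) G (row_mx a (F b)).
Proof.
move=> FSb dG; have aS : Ck 0 (fun y => row_mx a (F y)) b.
  by apply: Ck_row_mx => //; exact: Ck_cst.
rewrite (@derive_comp _ _ _ _ (fun y => row_mx a (F y)) G _ _
  (Ck_differentiable aS) dG).
by rewrite (derive_row_mx _ (Ck_cst _ _ _) FSb) derive_cst.
Qed.

Lemma near_row_l : \forall a \near xi, Ck 4 E (row_mx a (F xi)).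
Proof.
exact: (@Ck_near _ _ _ 0 (fun x => row_mx x (F xi)) xi _
  (Ck_row_mx (Ck_id _ _) (Ck_cst _ _ _)) EU).
Qed.

Lemma near_row_r : \forall b \near xi, Ck 4 E (row_mx xi (F b)).
Proof.
exact: (@Ck_near _ _ _ 2 (fun y => row_mx xi (F y)) xi _
  (Ck_row_mx (Ck_cst _ _ _) FS) EU).
Qed.

Lemma near_graph : \forall b \near xi, Ck 4 E (row_mx b (F b)).
Proof. exact: (@Ck_near _ _ _ 2 (fun b => row_mx b (F b)) xi _ Ck_graph EU). Qed.

Lemma Ck_kappa : Ck 2 kappa xi.
Proof.
apply: CkD; last exact: CkN.
apply: (@Ck_comp _ _ _ 2 (fun b => row_mx b (F b)) E); first exact: Ck_graph.
exact: Ck_le ES.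
Qed.

Let Fd v := 'D_v F xi.
(** Up to constants, [P (Fd v)] and [H v] are the derivatives of [D] at [xi] along [v] in the second
    and in the first argument, as functions of the other argument. They are the families to which
    the lowered primal and dual equations apply. *)
Let P (b : 'rV[R]_n) (a : 'rV[R]_n) := 'D_(Rv b) E (row_mx a (F xi)).
Let H (a : 'rV[R]_n) (b : 'rV[R]_n) := 'D_(Lv a) E (row_mx xi (F b)).

Lemma derive_snd v : \forall a \near xi,
  'D_v (fun b => D a b) xi = P (Fd v) a - 'D_v kappa xi.
Proof.
apply: filterS near_row_l => a Ea.
have dE := Ck_differentiable Ea.
rewrite (@near_eq_derive _ _ _ _
    ((fun b => E (row_mx a (F b)) - ph a) - kappa)); last first.
  by apply: filterS DE => b; exact.
have dk : derivable kappa xi v by exact: Ck_derivable Ck_kappa.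
have FS0 : Ck 0 F xi by exact: Ck_le FS.
have dEa : derivable (fun b => E (row_mx a (F b))) xi v.
  by apply: (@Ck_derivable _ _ _ 0); apply: Ck_row_r => //; exact: Ck_le Ea.
rewrite (deriveB (derivableB dEa (derivable_cst _ _ _)) dk).
by rewrite derive_subr (derive_row_r _ FS0 dE).
Qed.

Lemma derive_fst v : \forall b \near xi,
  'D_v (fun a => D a b) xi = H v b - 'D_v ph xi.
Proof.
apply: filterS2 near_row_r DE => b Eb DEb.
have -> : (fun a => D a b) = fun a => (E (row_mx a (F b)) - ph a) - kappa b.
  by apply/funext.
rewrite derive_subr.
have dE : derivable (fun a => E (row_mx a (F b))) xi v.
  apply: (@Ck_derivable _ _ _ 0).
  apply: (@Ck_comp _ _ _ 0 (fun x => row_mx x (F b)) E); last exact: Ck_le Eb.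
  by apply: Ck_row_mx; [exact: Ck_id|exact: Ck_cst].
rewrite [LHS](deriveB dE); last exact: Ck_derivable phS.
by rewrite derive_row_mxl.
Qed.

Lemma div_metricE k m :
  div_metric D xi k m = - 'D_(basis_vec R k) (P (Fd (basis_vec R m))) xi.
Proof.
rewrite /div_metric mxE; apply: (congr1 (@GRing.opp _)).
rewrite /partial.
have H1 := near_eq_derive (basis_vec R k) (derive_snd (basis_vec R m)).
have H2 := derive_subr (P (Fd (basis_vec R m))) ('D_(basis_vec R m) kappa xi) xi
  (basis_vec R k).
exact: etrans H1 H2.
Qed.

Lemma primal_lowerE i j m :
  primal_lower D i j m xi =
  - 'D_(basis_vec R i) ('D_(basis_vec R j) (P (Fd (basis_vec R m)))) xi.
Proof.
rewrite /primal_lower; apply: (congr1 (@GRing.opp _)); apply: near_eq_derive.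
apply: filterS (near_near (derive_snd (basis_vec R m))) => a nE.
rewrite /partial; apply: etrans (near_eq_derive (basis_vec R j) nE) _.
exact: (derive_subr (P (Fd (basis_vec R m))) ('D_(basis_vec R m) kappa xi) a).
Qed.

Lemma dual_lowerE i j m :
  dual_lower D i j m xi =
  - 'D_(basis_vec R i) ('D_(basis_vec R j) (H (basis_vec R m))) xi.
Proof.
rewrite /dual_lower; apply: (congr1 (@GRing.opp _)); apply: near_eq_derive.
apply: filterS (near_near (derive_fst (basis_vec R m))) => b nE.
rewrite /partial; apply: etrans (near_eq_derive (basis_vec R j) nE) _.
exact: (derive_subr (H (basis_vec R m)) ('D_(basis_vec R m) ph xi) b).
Qed.

Lemma Ck_P b : Ck 1 (P b) xi.
Proof.
apply: (@Ck_row_l _ _ ('D_(Rv b) E)); apply: Ck_derive.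
exact: (@Ck_le _ _ _ 2 4 E z isT ES).
Qed.

Lemma Ck_H a : Ck 1 (H a) xi.
Proof.
apply: (@Ck_row_r _ _ _ ('D_(Lv a) E)); first exact: CkW FS.
apply: Ck_derive; exact: (@Ck_le _ _ _ 2 4 E z isT ES).
Qed.

Lemma derive_P b v y : 'D_v (P b) y = 'D_(Lv v) ('D_(Rv b) E) (row_mx y (F xi)).
Proof. exact: (derive_row_mxl ('D_(Rv b) E)). Qed.

Lemma derive2_P b u v :
  'D_u ('D_v (P b)) xi = 'D_(Lv u) ('D_(Lv v) ('D_(Rv b) E)) z.
Proof.
have -> : 'D_v (P b) = fun y => 'D_(Lv v) ('D_(Rv b) E) (row_mx y (F xi)).
  by apply/funext => y; exact: derive_P.
exact: (derive_row_mxl ('D_(Lv v) ('D_(Rv b) E))).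
Qed.

Lemma derive_H a v : 'D_v (H a) xi = 'D_(Rv (Fd v)) ('D_(Lv a) E) z.
Proof.
apply: (@derive_row_r _ _ _ ('D_(Lv a) E)); first exact: (@Ck_le _ _ _ 0 2 F xi isT FS).
apply: (@Ck_differentiable _ _ _ 0); apply: Ck_derive.
exact: (@Ck_le _ _ _ 1 4 E z isT ES).
Qed.

(** For fixed second argument [b] the divergence is minimal at [b], so its derivative in the first
    argument vanishes on the diagonal. *)
Lemma first_order a : \forall b \near xi,
  'D_(Lv a) E (row_mx b (F b)) = 'D_a ph b.
Proof.
apply: filterS3 Dmin near_graph (near_Ck0 phS) => b minb Eb phb.
have ES0 : Ck 0 (fun x => E (row_mx x (F b))) b.
  apply: (@Ck_comp _ _ _ 0 (fun x => row_mx x (F b)) E).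
    exact: Ck_row_mx (Ck_id _ _) (Ck_cst _ _ _).
  exact: (@Ck_le _ _ _ 0 4 E _ isT Eb).
have dS := CkD ES0 (CkN phb).
have := @derive_at_min _ _ _ b a (Ck_differentiable dS) minb.
have d1 : derivable (fun x => E (row_mx x (F b))) b a by exact: Ck_derivable ES0.
have d2 : derivable ph b a by exact: Ck_derivable phb.
rewrite (deriveB d1 d2).
rewrite derive_row_mxl => /eqP; rewrite subr_eq0 => /eqP; exact.
Qed.

Lemma derive_row_mxD (G : 'rV[R]_(n + n) -> R) a b y : differentiable G y ->
  'D_(row_mx a b) G y = 'D_(Lv a) G y + 'D_(Rv b) G y.
Proof.
move=> dG; rewrite !deriveE// -linearD; congr ('d _ _ _).
by rewrite add_row_mx addr0 add0r.
Qed.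

(** Differentiate [first_order] along the graph of [F], whose tangent vector over [v] is
    [(v, Fd v)]. *)
Lemma second_order a v : 'D_(Rv (Fd v)) ('D_(Lv a) E) z =
  'D_v ('D_a ph) xi - 'D_(Lv v) ('D_(Lv a) E) z.
Proof.
have dLE : differentiable ('D_(Lv a) E) z.
  apply: (@Ck_differentiable _ _ _ 0); apply: Ck_derive.
  exact: (@Ck_le _ _ _ 1 4 E z isT ES).
rewrite -(near_eq_derive v (first_order a)).
rewrite (@derive_comp _ _ _ _ (fun b => row_mx b (F b)) ('D_(Lv a) E) xi v
  (Ck_differentiable Ck_graph) dLE).
have FS0 := @Ck_le _ _ _ 0 2 F xi isT FS.
rewrite (derive_row_mx v (Ck_id _ _) FS0) derive_id.
by rewrite (derive_row_mxD v (Fd v) dLE) addrAC subrr add0r.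
Qed.

(** The right side of [second_order] consists of Hessians and is symmetric in [a] and [v]. *)
Lemma metric_sym a v :
  'D_(Rv (Fd v)) ('D_(Lv a) E) z = 'D_(Rv (Fd a)) ('D_(Lv v) E) z.
Proof.
have ES2 := @Ck_le _ _ _ 2 4 E z isT ES.
rewrite (second_order a v) (second_order v a).
by rewrite (derive_comm a v phS) (derive_comm (Lv a) (Lv v) ES2).
Qed.

(** Symmetry lets the metric be read as a derivative of [H] instead of [P], the form that
    [lowered_geodesic] requires for the dual connection. *)
Lemma div_metricEH k m :
  div_metric D xi k m = - 'D_(basis_vec R k) (H (basis_vec R m)) xi.
Proof.
have ES2 := @Ck_le _ _ _ 2 4 E z isT ES.
rewrite div_metricE derive_P derive_H; apply: (congr1 (@GRing.opp _)).
apply: etrans (metric_sym (basis_vec R k) (basis_vec R m)).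
exact: (derive_comm (Lv (basis_vec R k)) (Rv (Fd (basis_vec R m))) ES2).
Qed.

Let J := jacobian F xi.

Lemma Fd_jacobian v : Fd v = v *m J.
Proof. exact: deriveEjacobian (Ck_differentiable FS). Qed.

Lemma jacobian_unit : J \in unitmx.
Proof.
rewrite -row_free_unit -kermx_eq0; apply/eqP/row_matrixP => i; rewrite row0.
by apply: Finj; rewrite -/(Fd _) Fd_jacobian -row_mul mulmx_ker row0.
Qed.

(** The second argument of the divergence moves through [F], so the metric is minus the mixed
    Hessian times the transposed Jacobian of [F]. *)
Lemma div_metric_unit : div_metric D xi \in unitmx.
Proof.
have -> : div_metric D xi = (- 1) *: (cost_hessian E z *m J^T).
  apply/matrixP => k m; rewrite div_metricE derive_P mxE mulN1r; congr (- _).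
  rewrite -mixed_derive; last exact: (@Ck_le _ _ _ 1 4 E z isT ES).
  rewrite /mixed Fd_jacobian trmx_mul trmx_delta mulmxA -colE mxE -mulmxA -rowE.
  by rewrite mxE.
by rewrite unitmxZ ?unitrN1// unitmx_mul CU unitmx_tr jacobian_unit.
Qed.

Lemma primal_equation (u w : 'rV[R]_n) :
  (forall k, w 0 k + \sum_(i < n) \sum_(j < n)
     primal_connection D i j k xi * u 0 i * u 0 j = 0) ->
  forall b, 'D_(Lv w) ('D_(Rv b) E) z +
    'D_(Lv u) ('D_(Lv u) ('D_(Rv b) E)) z = 0.
Proof.
move=> geo b; rewrite -derive_P -derive2_P.
(* The coordinates of [b] in the basis of the vectors [Fd (basis_vec R m)], the directions in which
   the lowered equation is given. *)
pose beta := b *m invmx J.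
have := @lowered_geodesic _ _ _ _ (fun m => P (Fd (basis_vec R m))) xi u w
  (fun m => Ck_P _) div_metric_unit div_metricE primal_lowerE geo.
apply: (@geodesic_comb _ _ _ (P b) (fun m => beta 0 m)) => [m|]; first exact: Ck_P.
apply: filterS near_row_l => y Ey; rewrite /P.
have dE : differentiable E (row_mx y (F xi)) by exact: Ck_differentiable Ey.
rewrite deriveE//.
have -> : Rv b = \sum_m beta 0 m *: Rv (Fd (basis_vec R m)) :> 'rV[R]_(n + n).
  have RvE (d : 'rV[R]_n) : Rv d = d *m row_mx 0 1%:M.
    by rewrite mul_mx_row mulmx1 mulmx0.
  rewrite RvE -(mulmxKV jacobian_unit b) -/beta {1}(rV_sum_basis beta) !mulmx_suml.
  by apply: eq_bigr => m _; rewrite RvE Fd_jacobian -!scalemxAl.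
rewrite linear_sum; apply: eq_bigr => m _.
by rewrite linearZ -deriveE.
Qed.

Lemma dual_equation (u w : 'rV[R]_n) :
  (forall k, w 0 k + \sum_(i < n) \sum_(j < n)
     dual_connection D i j k xi * u 0 i * u 0 j = 0) ->
  forall a, 'D_w (H a) xi + 'D_u ('D_u (H a)) xi = 0.
Proof.
move=> geo a.
have := @lowered_geodesic _ _ _ _ (fun m => H (basis_vec R m)) xi u w
  (fun m => Ck_H _) div_metric_unit div_metricEH dual_lowerE geo.
apply: (@geodesic_comb _ _ _ (H a) (fun m => a 0 m)) => [m|]; first exact: Ck_H.
apply: filterS near_row_r => y Ey; apply: derive_Lv_sum.
exact: Ck_differentiable Ey.
Qed.


Hypothesis CUn : \forall y \near z, cost_hessian E y \in unitmx.

(** Since [eta] is [F] applied to [om], the function [H a] along [om] is the derivative of [E] along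
    [(a, 0)] at [(xi, eta)]. Computing its second derivative both ways carries the equation from
    [om] to [eta]. *)
Lemma dual_second_order (om eta : R -> 'rV[R]_n) : Ck 1 om 0 -> Ck 1 eta 0 ->
  om 0 = xi -> (\forall t \near 0, eta t = F (om t)) ->
  (forall k, ('D_1 ('D_1 om) 0) 0 k + \sum_(i < n) \sum_(j < n)
     dual_connection D i j k xi * ('D_1 om 0) 0 i * ('D_1 om 0) 0 j = 0) ->
  forall a, 'D_(Rv ('D_1 eta 0)) ('D_(Rv ('D_1 eta 0)) ('D_(Lv a) E)) z +
    'D_(Rv ('D_1 ('D_1 eta) 0)) ('D_(Lv a) E) z = 0.
Proof.
move=> omS etaS om0 etaE geo a.
have eta0 : eta 0 = F xi by rewrite (nbhs_singleton etaE) om0.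
have GS : Ck 1 ('D_(Lv a) E) (row_mx xi (eta 0)).
  by rewrite eta0; apply: Ck_derive; exact: (@Ck_le _ _ _ 2 4 E z isT ES).
have HS : Ck 1 (H a) (om 0) by rewrite om0; exact: Ck_H.
have := derive2_curve_r etaS GS; rewrite eta0 => <-.
have HE : \forall t \near 0,
    (H a \o om) t = 'D_(Lv a) E (row_mx xi (eta t)).
  by apply: filterS etaE => t ->.
rewrite -(near_eq_derive _ (near_eq_near_derive _ HE)).
rewrite (derive2_comp _ omS HS) om0 addrC.
exact: dual_equation geo a.
Qed.

Lemma derive2D (V : normedModType R) (G1 G2 : V -> R) (y v : V) :
  Ck 1 G1 y -> Ck 1 G2 y ->
  'D_v ('D_v (G1 + G2)) y = 'D_v ('D_v G1) y + 'D_v ('D_v G2) y.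
Proof.
move=> S1 S2.
rewrite (@near_eq_derive _ _ _ _ ('D_v G1 + 'D_v G2)).
  by apply: deriveD; [exact: Ck_derivable (Ck_derive _ S1)
                     |exact: Ck_derivable (Ck_derive _ S2)].
apply: filterS2 (Ck_near_differentiable S1) (Ck_near_differentiable S2) => t d1 d2.
exact: (deriveD (diff_derivable d1) (diff_derivable d2)).
Qed.

Lemma derive_opp_dir (b : 'rV[R]_n) (y : 'rV[R]_(n + n)) : differentiable E y ->
  'D_(Rv (- b)) E y = (- 'D_(Rv b) E) y.
Proof.
move=> dE; rewrite deriveE//.
have -> : Rv (- b) = - Rv b :> 'rV[R]_(n + n) by rewrite opp_row_mx oppr0.
by rewrite linearN -deriveE.
Qed.

Lemma near_deriveN (G1 G2 : 'rV[R]_(n + n) -> R) (y v : 'rV[R]_(n + n)) :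
  (\forall t \near y, G1 t = (- G2) t) -> (\forall t \near y, differentiable G2 t) ->
  \forall t \near y, 'D_v G1 t = (- 'D_v G2) t.
Proof.
move=> /near_near GE; apply: filterS2 GE => t GEt dG.
by rewrite (near_eq_derive _ GEt) deriveN//; exact: diff_derivable.
Qed.

Lemma mtw_fourth_derivative (w om eta : R -> 'rV[R]_n) (k1 k2 : R -> R)
    (Phi : R -> R -> R) :
  Ck 1 w 0 -> Ck 1 om 0 -> Ck 1 eta 0 -> Ck 1 k2 0 ->
  w 0 = xi -> om 0 = xi -> (\forall t \near 0, eta t = F (om t)) ->
  (\forall s \near 0, \forall t \near 0,
     Phi s t = E (row_mx (w s) (eta t)) - k1 s - k2 t) ->
  (forall k, ('D_1 ('D_1 w) 0) 0 k + \sum_(i < n) \sum_(j < n)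
     primal_connection D i j k xi * ('D_1 w 0) 0 i * ('D_1 w 0) 0 j = 0) ->
  (forall k, ('D_1 ('D_1 om) 0) 0 k + \sum_(i < n) \sum_(j < n)
     dual_connection D i j k xi * ('D_1 om 0) 0 i * ('D_1 om 0) 0 j = 0) ->
  2 * sec (h_form (fun a b => E (row_mx a b)))
        (cst (Lv ('D_1 w 0))) (cst (Rv ('D_1 eta 0))) z =
  - 'D_1 ('D_1 (fun s => 'D_1 ('D_1 (Phi s)) 0)) 0.
Proof.
move=> wS omS etaS kS w0 om0 etaE PhiE geoP geoD.
have eta0 : eta 0 = F xi by rewrite (nbhs_singleton etaE) om0.
have PE := primal_equation geoP.
have DU := dual_second_order omS etaS om0 etaE geoD.
have FD := fourth_derivative EU w0 eta0 wS etaS kS PhiE.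
set u := 'D_1 w 0 in PE FD *; set v := 'D_1 eta 0 in DU FD *.
set w2 := 'D_1 ('D_1 w) 0 in PE FD; set e2 := 'D_1 ('D_1 eta) 0 in DU FD.
have ES2 := @Ck_le _ _ _ 2 4 E z isT ES.
have ES3 := @Ck_le _ _ _ 3 4 E z isT ES.
have EU2 := near_Ck_le (isT : 2 <= 4)%N EU.
have EU3 := near_Ck_le (isT : 3 <= 4)%N EU.
have dE : \forall y \near z, differentiable E y := Ck_near_differentiable ES.
have dDE b : \forall y \near z, differentiable ('D_b E) y.
  exact: Ck_near_differentiable (Ck_derive b ES).
have dDDE a b : \forall y \near z, differentiable ('D_a ('D_b E)) y.
  exact: Ck_near_differentiable (Ck_derive a (Ck_derive b ES)).
(* The vector [- e2] is the one to be fed to [sec_h_form]; its sign is first pulled out of the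
   derivatives. *)
have oppE : \forall y \near z, 'D_(Rv (- e2)) E y = (- 'D_(Rv e2) E) y.
  by apply: filterS dE => y; exact: derive_opp_dir.
have oppL a : 'D_(Lv a) ('D_(Rv (- e2)) E) z = - 'D_(Lv a) ('D_(Rv e2) E) z.
  exact: nbhs_singleton (near_deriveN (Lv a) oppE (dDE (Rv e2))).
have oppLL : 'D_(Lv u) ('D_(Lv u) ('D_(Rv (- e2)) E)) z =
    - 'D_(Lv u) ('D_(Lv u) ('D_(Rv e2) E)) z.
  exact: nbhs_singleton (near_deriveN (Lv u)
    (near_deriveN (Lv u) oppE (dDE (Rv e2))) (dDDE (Lv u) (Rv e2))).
have vvL a : 'D_(Rv v) ('D_(Rv v) ('D_(Lv a) E)) z =
    'D_(Rv v) ('D_(Lv a) ('D_(Rv v) E)) z.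
  exact: derive_comm_near EU2.
have vLv a : 'D_(Rv v) ('D_(Lv a) ('D_(Rv v) E)) z =
    'D_(Lv a) ('D_(Rv v) ('D_(Rv v) E)) z.
  exact: derive_comm (Ck_derive (Rv v) ES3).
have e2L a : 'D_(Rv e2) ('D_(Lv a) E) z = 'D_(Lv a) ('D_(Rv e2) E) z.
  exact: derive_comm ES2.
have wP a : 'D_(Lv a) ('D_(Rv (- e2)) E) z =
    'D_(Rv v) ('D_(Lv a) ('D_(Rv v) E)) z.
  exact: cancel_opp (oppL a) (e2L a) (vvL a) (DU a).
have SEC := sec_h_form u EU CUn wP.
have X : 'D_(Lv u) ('D_(Rv v) ('D_(Lv u) ('D_(Rv v) E))) z =
    'D_(Lv u) ('D_(Lv u) ('D_(Rv v) ('D_(Rv v) E))) z.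
  exact: derive_comm_near (near_Ck_derive (Rv v) EU3).
have A1S : Ck 1 ('D_(Rv v) ('D_(Rv v) E)) z by exact: Ck_derive (Ck_derive _ ES3).
have A2S : Ck 1 ('D_(Rv e2) E) z by exact: Ck_derive ES2.
have AD : 'D_(Lv w2) ('D_(Rv v) ('D_(Rv v) E) + 'D_(Rv e2) E) z =
    'D_(Lv w2) ('D_(Rv v) ('D_(Rv v) E)) z + 'D_(Lv w2) ('D_(Rv e2) E) z.
  exact: (deriveD (Ck_derivable A1S) (Ck_derivable A2S)).
(* [DU] at [w2] makes the two terms along [(w2, 0)] cancel, and the remaining ones form the
   curvature expression up to sign. *)
apply: (cancel_mixed SEC oppLL _ (PE e2) (DU w2) _ (e2L w2)).
  apply: etrans FD _; apply: (congr2 +%R _ AD).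
  exact: etrans (derive2D (Lv u) A1S A2S) (congr1 (fun t => t + _) (esym X)).
exact (etrans (vvL w2) (vLv w2)).
Qed.

End divergence.

(** * The c-transform on the range of the c-gradient *)

Section c_transform.
Variables (R : realType) (M M' : Type) (c : M -> M' -> R) (phi : M -> R)
  (f : M -> M').
Hypothesis f_gradient : is_c_gradient c phi f.

(** The sum defining [f p] is a real number, which excludes infinite values of the c-transform there
    and allows solving for it. *)
Lemma c_transform_gradient p :
  c_transform c phi (f p) = (c p (f p) - phi p)%:E.
Proof.
have := (f_gradient p (f p)).2 erefl.
case: (c_transform c phi (f p)) => [r| |] //= [rE].
by rewrite -rE addrAC subrr add0r.
Qed.

Lemma c_transform_le p p' : c p (f p) - phi p <= c p' (f p) - phi p'.
Proof.
rewrite -lee_fin -c_transform_gradient; apply: ereal_inf_lbound.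
by exists p'.
Qed.

End c_transform.

(** * Maps and curves read in charts *)

Section charts.
Variables (R : realType) (n : nat) (M M' : topologicalType).
Variables (x : chart R n M) (x_chart : is_chart x) (y : chart R n M').
Hypothesis y_chart : is_chart y.

Lemma cimg_dom a : cimg x a -> cdom x (cinv x a) /\ cmap x (cinv x a) = a.
Proof. by case=> p xp <-; have [_ _ xK _ _] := x_chart; rewrite xK. Qed.

Lemma near_cimg p : cdom x p -> \forall a \near cmap x p, cimg x a.
Proof.
move=> xp; have [_ oimg _ _ _] := x_chart.
by apply: open_nbhs_nbhs; split=> //; exists p.
Qed.

Lemma cinv_continuous_at p : cdom x p -> cinv x a @[a --> cmap x p] --> p.
Proof.
move=> xp; have [_ _ xK _ cinvx] := x_chart.
rewrite -[X in _ --> X](xK _ xp); apply: cinvx; by exists p.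
Qed.

Lemma smooth_map_on_Ck (A : smooth_manifold R n M) (A' : smooth_manifold R n M')
    (U : set M) (f : M -> M') p k : atlas A x -> atlas A' y ->
  smooth_map_on A A' U f -> open U -> U p -> cdom x p -> cdom y (f p) ->
  (\forall a \near cmap x p, cdom y (f (cinv x a))) /\
  Ck k (cmap y \o f \o cinv x) (cmap x p).
Proof.
move=> xA yA [fc fS] oU Up xp yfp.
have [_ _ xK _ _] := x_chart; have [oy _ _ _ _] := y_chart.
have nyf : \forall p' \near p, cdom y (f p').
  by apply: fc => //; exact: open_nbhs_nbhs.
have nU : \forall p' \near p, U p' by exact: open_nbhs_nbhs.
have nyfa : \forall a \near cmap x p, cdom y (f (cinv x a)).
  exact: (cinv_continuous_at xp nyf).
have nUa : \forall a \near cmap x p, U (cinv x a).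
  exact: (cinv_continuous_at xp nU).
split=> //; apply: (smooth_on_Ck k (fS x y xA yA)).
apply: filterS3 (near_cimg xp) nUa nyfa => a ia Ua ya.
by have [xa aE] := cimg_dom ia; exists (cinv x a).
Qed.

End charts.

Lemma derive1n2E (R : realType) (V : normedModType R) (F : R -> V) t :
  derive1n 2 F t = 'D_1 ('D_1 F) t.
Proof.
rewrite /derive1n /= derive1E (_ : derive1 F = 'D_1 F)//.
by apply/funext => s; exact: derive1E.
Qed.

Lemma smooth_curve_Ck (R : realType) (n : nat) (M : topologicalType)
    (A : smooth_manifold R n M) (x : chart R n M) (I : set R) (p : R -> M) k :
  atlas A x -> open I -> I 0 -> smooth_curve A I p -> cdom x (p 0) ->
  (\forall s \near 0, cdom x (p s)) /\ Ck k (cmap x \o p : R -> _) 0.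
Proof.
move=> xA oI I0 [pc pS] xp0.
have [ox _ _ _ _] := atlas_chart xA.
have nx : \forall s \near 0, cdom x (p s) by apply: pc => //; exact: open_nbhs_nbhs.
have nI : \forall s \near 0, I s by exact: open_nbhs_nbhs.
split=> //; apply: (smooth_on_Ck k (pS x xA)).
by apply: filterS2 nI nx => s Is xs; split.
Qed.

(** * From the manifolds to the coordinate identity *)

Theorem corollary1 (R : realType) (n : nat) (hn : (2 <= n)%N)
    (M M' : topologicalType)
    (A : smooth_manifold R n M) (A' : smooth_manifold R n M')
    (c : M -> M' -> R) (c_smooth : smooth_fun2 A A' c)
    (c_nondeg : nondegenerate_cost A A' c)
    (phi : M -> R) (phi_smooth : smooth_fun A phi)
    (phi_concave : c_concave c phi)
    (f : M -> M') (finv : M' -> M) (f_gradient : is_c_gradient c phi f)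
    (f_diffeo : diffeo_onto_range A A' f finv)
    (p : M) (q : M') (pq_graph : graph f (p, q))
    (* u and v are given by components in arbitrary charts x at p and y at q *)
    (x : chart R n M) (x_atlas : atlas A x) (x_p : cdom x p)
    (y : chart R n M') (y_atlas : atlas A' y) (y_q : cdom y q)
    (u v : 'rV[R]_n)
    (I J : set R) (I_open : open I) (I_itv : is_interval I) (I0 : I 0)
    (J_open : open J) (J_itv : is_interval J) (J0 : J 0)
    (pc : R -> M) (qc : R -> M')
    (gam := fun s : R => (pc s, f (pc s)))
    (sig := fun t : R => (finv (qc t), qc t))
    (gam_geodesic : primal_geodesic A c phi f I gam)
    (sig_geodesic : dual_geodesic A c phi f J sig)
    (gam0 : gam 0 = (p, q)) (sig0 : sig 0 = (p, q))
    (pc_velocity : derive1 (fun s : R => cmap x (pc s)) 0 = u)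
    (qc_velocity : derive1 (fun t : R => cmap y (qc t)) 0 = v) :
  mtw_tensor c x y p q u v =
  - derive1n 2 (fun s : R =>
      derive1n 2 (fun t : R => c_divergence c phi (gam s) (sig t)) 0) 0.
Proof.
have [xC yC] := (atlas_chart x_atlas, atlas_chart y_atlas).
have [_ _ xK _ _] := xC; have [_ _ yK _ _] := yC.
have qE : q = f p by exact: pq_graph.
have [pc0 _] := gam0; have [fq0 qc0] := sig0.
have [fK orange fS finvS] := f_diffeo.
have yfp : cdom y (f p) by rewrite -qE.
set xi := cmap x p.
pose E (z : 'rV[R]_(n + n)) := c (cinv x (lsubmx z)) (cinv y (rsubmx z)).
pose F := cmap y \o f \o cinv x.
pose ph := phi \o cinv x.
have Fxi : F xi = cmap y q by rewrite /F /xi /= xK// -qE.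
pose kappa b := E (row_mx b (F b)) - ph b.
have [nyf FS] := smooth_map_on_Ck xC yC 2 x_atlas y_atlas fS openT Logic.I x_p yfp.
have nx := near_cimg xC x_p; have ny := near_cimg yC y_q.
have EE a b : E (row_mx a b) = c (cinv x a) (cinv y b).
  by rewrite /E row_mxKl row_mxKr.
pose U := [set z : 'rV[R]_(n + n) | cimg x (lsubmx z) /\ cimg y (rsubmx z)].
have nU : \forall z \near row_mx xi (F xi), U z.
  have nl : \forall z \near row_mx xi (F xi), cimg x (lsubmx z).
    by apply: continuous_lsubmx; rewrite row_mxKl.
  have nr : \forall z \near row_mx xi (F xi), cimg y (rsubmx z).
    by apply: continuous_rsubmx; rewrite row_mxKr Fxi.
  by apply: filterS2 nl nr => z ? ?; split.
have EU : \forall z \near row_mx xi (F xi), Ck 4 E z.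
  apply: filterS (near_near nU) => z.
  exact: smooth_on_Ck (c_smooth x y x_atlas y_atlas).
have costE : (fun a b => E (row_mx a b)) = local_cost c x y.
  by apply/funext => a; apply/funext => b; exact: EE.
have CUn : \forall z \near row_mx xi (F xi), cost_hessian E z \in unitmx.
  apply: filterS nU => z [[p' xp' xz] [q' yq' yz]].
  rewrite /cost_hessian -xz -yz costE.
  exact: c_nondeg.
have phS : Ck 2 ph xi by exact: smooth_on_Ck (phi_smooth x x_atlas) nx.
have FyE b : cdom y (f (cinv x b)) -> forall a,
    E (row_mx a (F b)) = c (cinv x a) (f (cinv x b)).
  by move=> yb a; rewrite EE /F /= yK.
have DE : \forall b \near xi, forall a, local_divergence c phi f x a b =
    E (row_mx a (F b)) - ph a - kappa b.
  apply: filterS nyf => b yb a; rewrite /kappa !FyE//.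
  by rewrite /local_divergence /c_divergence/= (c_transform_gradient f_gradient).
(* Here [a] may lie outside the chart image: [cinv x a] is then still some point of [M], and the
   infimum is over all of [M]. *)
have Dmin : \forall b \near xi, forall a,
    kappa b <= E (row_mx a (F b)) - ph a.
  apply: filterS nyf => b yb a; rewrite /kappa !FyE//.
  exact: (c_transform_le f_gradient).
(* In charts [finv] gives a differentiable local left inverse of [F], and the chain rule is applied
   to the identity. *)
have Finj e : 'D_e F xi = 0 -> e = 0.
  have xfq : cdom x (finv q) by rewrite -qc0 fq0.
  have rq : range f q by exists p.
  have [_ GS] := smooth_map_on_Ck yC xC 2 y_atlas x_atlas finvS orange rq y_q xfq.
  pose G := cmap x \o finv \o cinv y.
  have GK : \forall b \near xi, (G \o F) b = id b.
    apply: filterS2 nyf nx => b yb xb; rewrite /G /F /= yK// fK.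
    by have [] := cimg_dom xC xb.
  move=> Fe0; rewrite -(derive_id xi e) -(near_eq_derive e GK).
  have dG : differentiable G (F xi) by rewrite Fxi; exact: Ck_differentiable GS.
  by rewrite (derive_comp e (Ck_differentiable FS) dG) Fe0 derive0.
have [_ pcS geoP] := gam_geodesic; have [qcG omS geoD] := sig_geodesic.
have xpc0 : cdom x (pc 0) by rewrite pc0.
have xom0 : cdom x (finv (qc 0)) by rewrite fq0.
have [nxs wS] := smooth_curve_Ck 1 x_atlas I_open I0 pcS xpc0.
have [nxt omCS] := smooth_curve_Ck 1 x_atlas J_open J0 omS xom0.
have nJ : \forall t \near 0, J t by exact: open_nbhs_nbhs.
have qcE : \forall t \near 0, qc t = f (finv (qc t)).
  by apply: filterS nJ => t; exact: qcG.
pose w := cmap x \o pc; pose om := cmap x \o (finv \o qc).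
pose eta := cmap y \o qc.
have w0 : w 0 = xi by rewrite /w /= pc0.
have om0 : om 0 = xi by rewrite /om /= fq0.
have etaE : \forall t \near 0, eta t = F (om t).
  by apply: filterS2 nxt qcE => t xt qt; rewrite /eta /F /om /= xK// -qt.
have nyt : \forall t \near 0, cdom y (qc t).
  have := @Ck_near _ _ _ 1 om 0 (fun a => cdom y (f (cinv x a))) omCS.
  rewrite om0 => /(_ nyf) nyom.
  by apply: filterS3 nyom nxt qcE => t + xt qt; rewrite /om /= xK// -qt.
(* Smoothness of a curve in the graph is stated for its first component; that of [eta] is obtained
   through [F]. *)
have FomS : Ck 1 (F \o om) 0.
  apply: Ck_rV => i; apply: (@Ck_comp _ _ _ 1 om (fun a => F a 0 i) 0 omCS).
  by rewrite om0; apply: Ck_coord; exact: CkW.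
have etaS : Ck 1 eta 0.
  by apply: near_eq_Ck FomS; apply: filterS etaE => t ->.
pose k1 s := phi (pc s); pose k2 t := fine (c_transform c phi (qc t)).
(* Near 0 the c-transform along [qc], defined as an infimum, equals the differentiable function
   [kappa \o om]. *)
have k2S : Ck 1 k2 0.
  have kS := Ck_kappa EU FS phS.
  have : Ck 1 (kappa \o om) 0.
    by apply: (@Ck_comp _ _ _ 1 om kappa 0 omCS); rewrite om0; exact: CkW.
  apply: near_eq_Ck; apply: filterS3 nxt nyt qcE => t xt yt qt.
  have omK : cinv x (om t) = finv (qc t) by rewrite /om /= xK.
  rewrite /k2 qt (c_transform_gradient f_gradient) /kappa /=.
  by rewrite FyE /ph /= omK -?qt.
pose Phi s t := c_divergence c phi (gam s) (sig t).
have PhiE : \forall s \near 0, \forall t \near 0,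
    Phi s t = E (row_mx (w s) (eta t)) - k1 s - k2 t.
  apply: filterS nxs => s xs; apply: filterS nyt => t yt.
  by rewrite EE /w /eta /= xK// yK.
have geoP0 k : ('D_1 ('D_1 w) 0) 0 k + \sum_(i < n) \sum_(j < n)
    primal_connection (local_divergence c phi f x) i j k xi *
    ('D_1 w 0) 0 i * ('D_1 w 0) 0 j = 0.
  by rewrite -derive1n2E -derive1E -w0; exact: (geoP x x_atlas 0 I0 xpc0 k).
have geoD0 k : ('D_1 ('D_1 om) 0) 0 k + \sum_(i < n) \sum_(j < n)
    dual_connection (local_divergence c phi f x) i j k xi *
    ('D_1 om 0) 0 i * ('D_1 om 0) 0 j = 0.
  by rewrite -derive1n2E -derive1E -om0; exact: (geoD x x_atlas 0 J0 xom0 k).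
have core := mtw_fourth_derivative EU (nbhs_singleton CUn) FS phS DE Dmin Finj
  CUn wS omCS etaS k2S w0 om0 etaE PhiE geoP0 geoD0.
have uE : u = 'D_1 w 0 by rewrite -pc_velocity derive1E.
have vE : v = 'D_1 eta 0 by rewrite -qc_velocity derive1E.
have PhiD : (fun s => derive1n 2 (Phi s) 0) =
    (fun s => derive (derive (Phi s) ^~ 1) 0 1).
  by apply/funext => s; exact: derive1n2E.
have d4E := etrans (congr1 (fun G : R -> R => derive1n 2 G 0) PhiD)
  (derive1n2E _ 0).
rewrite /mtw_tensor -costE -/xi -Fxi uE vE.
exact (etrans core (congr1 (@GRing.opp R) (esym d4E))).
Qed.
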